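(* Let $M$ be a simply connected Delaunay triangulation of $\mathcal D_1$. Then the matrix $L^a$ is a Stieltjes matrix, and there is one and only one minimizer $f^*_M$ of the discrete conformal energy $E^C_M$ over $\mathcal S_M$, whose matrix form is $$\mathbf f^*_M=\begin{bmatrix}-(L^a)^{-1}L^b\,\mathbf f_b\\ \mathbf f_b\end{bmatrix}.$$
   Context: Let $a,b,w>0$, $\mathcal D_1=[0,a]\times[0,b]$, $\mathcal D_2=[0,wa]\times[0,b]$. Let $\mathcal O_1,\dots,\mathcal O_K,\mathcal L_1,\dots,\mathcal L_J\subseteq\mathcal D_1$ be such that $\mathcal O_1,\dots,\mathcal O_K,\mathcal L_1,\dots,\mathcal L_J,\partial\mathcal D_1$ are pairwise disjoint. Given data: $r_{\mathcal O}>0$; $2\times2$ diagonal matrices $R_{\mathcal L_j}$ with positive diagonal entries; vectors $\mathbf t_{\mathcal O_i},\mathbf t_{\mathcal L_j}\in\mathbb R^2$; and a bijective continuous map $g:\partial\mathcal D_1\to\partial\mathcal D_2$ with $g(0,0)=(0,0)$, $g(a,0)=(wa,0)$, $g(0,b)=(0,b)$, $g(a,b)=(wa,b)$. The mesh $M$ is a finite triangulation whose (closed, nondegenerate) triangles cover exactly $\mathcal D_1$; $\mathcal V(M),\mathcal E(M),\mathcal F(M)$ are its vertices, edges and triangles. Set - $\mathcal O_i(M)=\{\mathbf v\in\mathcal V(M): \mathbf v\in\tau\text{ for some }\tau\in\mathcal F(M)\text{ with }\tau\cap\mathcal O_i\ne\varnothing\}$; - $\mathcal L_j(M)$ = the set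 of vertices of triangles $\tau\in\mathcal F(M)$ with $\operatorname{int}(\tau)\cap\mathcal L_j\neq\varnothing$, together with the endpoints of edges $e\in\mathcal E(M)$ with $e\cap\mathcal L_j\ne\varnothing$; - $\mathcal B(M)=\mathcal V(M)\cap\partial\mathcal D_1$. The sets $\mathcal O_1(M),\dots,\mathcal O_K(M),\mathcal L_1(M),\dots,\mathcal L_J(M),\mathcal B(M)$ are assumed pairwise disjoint, and $\mathcal I(M)$ denotes the set of all remaining vertices. Let $n_v=|\mathcal V(M)|$, $n_i=|\mathcal I(M)|$, and order the vertices so that $\mathbf v_1,\dots,\mathbf v_{n_i}\in\mathcal I(M)$ and $\mathbf v_{n_i+1},\dots,\mathbf v_{n_v}\notin\mathcal I(M)$. $\mathcal S_M$ is the set of continuous maps $f:\mathcal D_1\to\mathbb R^2$ that are affine on each triangle of $M$ and satisfy $f(\mathbf v)=r_{\mathcal O}\mathbf v+\mathbf t_{\mathcal O_i}$ for $\mathbf v\in\mathcal O_i(M)$, $f(\mathbf v)=R_{\mathcal L_j}\mathbf v+\mathbf t_{\mathcal L_j}$ for $\mathbf v\in\mathcal L_j(M)$, and $f(\mathbf v)=g(\mathbf v)$ for $\mathbf v\in\mathcal B(M)$. The matrix form of $f\in\mathcal S_M$ is the $n_v\times2$ matrix $\mathbf f$ whose $\ell$-th row is $f(\mathbf v_\ell)$; $\mathbf f_b$ is the block of the last $n_v-n_i$ rows, which is prescribed by the constraints. The discrete conformal energy is $$E^C_M(f)=-\operatorname{Area}(\mathcal D_2)+\frac12\sum_{\tau\in\mathcal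 F(M)}\|\nabla f|_\tau\|^2\operatorname{Area}(\tau)$$ (Frobenius norm). For a triangle $\tau$ and a vertex $\mathbf v_i$ of $\tau$, let $(A_i^\tau,B_i^\tau)$ be the (constant) gradient on $\tau$ of the affine function equal to $1$ at $\mathbf v_i$ and $0$ at the other two vertices of $\tau$. Let $\mathcal N_i$ be the set of triangles containing $\mathbf v_i$. $L$ is the $n_i\times n_v$ matrix with entries $$(L)_{i,j}=\sum_{\tau\in\mathcal N_i,\ [\mathbf v_i,\mathbf v_j]\subset\tau}\operatorname{Area}(\tau)\,(A_i^\tau A_j^\tau+B_i^\tau B_j^\tau)\quad\text{if }j\ne i\text{ and }[\mathbf v_i,\mathbf v_j]\in\mathcal E(M),$$ $$(L)_{i,i}=\sum_{\tau\in\mathcal N_i}\operatorname{Area}(\tau)\,\big((A_i^\tau)^2+(B_i^\tau)^2\big),$$ and $(L)_{i,j}=0$ otherwise. Write $L=[\,L^a\ \ L^b\,]$ with $L^a$ the first $n_i$ columns. A Stieltjes matrix is a real symmetric positive definite matrix with nonpositive off-diagonal entries. *)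

(* Defs.v *)
From HB Require Import structures.
From mathcomp Require Import all_boot all_order all_algebra.
From mathcomp Require Import all_classical all_reals all_analysis.
Set Implicit Arguments.
Unset Strict Implicit.
Unset Printing Implicit Defensive.
Import Order.TTheory GRing.Theory Num.Theory.
Import numFieldNormedType.Exports.
Local Open Scope classical_set_scope.
Local Open Scope ring_scope.

(* Points of the plane are row vectors 'rV[R]_2, where R is any realType. *)

Definition pt (R : realType) (x y : R) : 'rV[R]_2 :=
  \row_(i < 2) (if i == 0 then x else y).

Definition rect (R : realType) (a b : R) : set 'rV[R]_2 :=
  [set p | (0 <= p 0 0 <= a) && (0 <= p 0 1 <= b)].

Definition frontier (T : topologicalType) (A : set T) : set T :=
  closure A `\` interior A.

(* The norm carried by 'rV[R]_2 in the library is the sup norm. *)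
Definition edist (R : realType) (x y : 'rV[R]_2) : R :=
  Num.sqrt (\sum_(i < 2) (x 0 i - y 0 i) ^+ 2).

Definition path_connected_set (R : realType) (A : set 'rV[R]_2) : Prop :=
  forall x y, A x -> A y ->
    exists c : R -> 'rV[R]_2,
      [/\ {within `[0, 1], continuous c}, set_fun `[0, 1] A c,
          c 0 = x & c 1 = y].

Definition simply_connected (R : realType) (A : set 'rV[R]_2) : Prop :=
  path_connected_set A /\
  forall c : R -> 'rV[R]_2,
    {within `[0, 1], continuous c} -> set_fun `[0, 1] A c -> c 0 = c 1 ->
    exists H : R * R -> 'rV[R]_2,
      [/\ {within `[0, 1] `*` `[0, 1], continuous H},
          set_fun (`[0, 1] `*` `[0, 1]) A H,
          forall t : R, 0 <= t <= 1 -> H (0, t) = c t,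
          forall t : R, 0 <= t <= 1 -> H (1, t) = c 0 &
          forall s : R, 0 <= s <= 1 -> H (s, 0) = c 0 /\ H (s, 1) = c 0].

(* A triangle is given by the set of (the indices of) its vertices. *)
Record mesh (R : realType) (n : nat) := Mesh {
  vtx : 'I_n -> 'rV[R]_2;
  faces : {set {set 'I_n}}
}.

(* Convex hull of the vertices indexed by s: the closed triangle, edge or
   vertex spanned by s when s is a simplex. *)
Definition hull (R : realType) (n : nat) (M : mesh R n) (s : {set 'I_n}) :
    set 'rV[R]_2 :=
  [set x | exists c : 'I_n -> R,
     [/\ forall k, 0 <= c k, \sum_(k in s) c k = 1 &
         x = \sum_(k in s) c k *: vtx M k]].

Definition affinely_independent (R : realType) (n : nat) (M : mesh R n)
    (s : {set 'I_n}) : Prop :=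
  forall c : 'I_n -> R,
    \sum_(k in s) c k = 0 -> \sum_(k in s) c k *: vtx M k = 0 ->
    forall k, k \in s -> c k = 0.

Definition edges (R : realType) (n : nat) (M : mesh R n) : {set {set 'I_n}} :=
  [set e : {set 'I_n} |
    (#|e| == 2)%N && [exists tau in faces M, e \subset tau]]%SET.

Definition mesh_support (R : realType) (n : nat) (M : mesh R n) : set 'rV[R]_2 :=
  [set x | exists2 tau, tau \in faces M & hull M tau x].

(* The fourth clause says that two triangles meet exactly in the simplex spanned
   by their common vertices (possibly empty, since hull M set0 is empty). *)
Definition triangulation_of (R : realType) (n : nat) (M : mesh R n)
    (D : set 'rV[R]_2) : Prop :=
  [/\ injective (vtx M),
      forall tau, tau \in faces M -> #|tau| = 3%N /\ affinely_independent M tau,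
      forall k, exists2 tau, tau \in faces M & k \in tau,
      forall sigma tau, sigma \in faces M -> tau \in faces M ->
        hull M sigma `&` hull M tau = hull M (sigma :&: tau) &
      mesh_support M = D].

(* No vertex lies strictly inside the circumscribed circle of a triangle. *)
Definition delaunay (R : realType) (n : nat) (M : mesh R n) : Prop :=
  forall tau, tau \in faces M ->
  forall (c : 'rV[R]_2) (r : R),
    (forall i, i \in tau -> edist c (vtx M i) = r) ->
    forall k, r <= edist c (vtx M k).

(* The enumeration order of tau only affects the sign of the determinant. *)
Definition area (R : realType) (n : nat) (M : mesh R n) (tau : {set 'I_n}) : R :=
  let p := nth 0 [seq vtx M i | i in tau] in
  `|\det (col_mx (p 1%N - p 0%N) (p 2%N - p 0%N) : 'M[R]_2)| / 2.

Definition affine_on (R : realType) (m : nat) (A : set 'rV[R]_2)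
    (f : 'rV[R]_2 -> 'rV[R]_m) : Prop :=
  exists (G : 'M[R]_(2, m)) (c : 'rV[R]_m), forall x, A x -> f x = x *m G + c.

(* Linear part of f when f is affine on A; as maps act on row vectors, this is
   the transpose of the usual Jacobian matrix. It is unique if A is a
   nondegenerate triangle. *)
Definition grad_on (R : realType) (m : nat) (A : set 'rV[R]_2)
    (f : 'rV[R]_2 -> 'rV[R]_m) : 'M[R]_(2, m) :=
  xget 0 [set G | exists c : 'rV[R]_m, forall x, A x -> f x = x *m G + c].

(* Gradient of the affine function equal to 1 at vertex i of tau and to 0 at the
   other vertices of tau. *)
Definition hat_grad (R : realType) (n : nat) (M : mesh R n) (tau : {set 'I_n})
    (i : 'I_n) : 'cV[R]_2 :=
  xget 0 [set G : 'cV[R]_2 | exists c : R,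
    forall j, j \in tau -> (vtx M j *m G) 0 0 + c = (j == i)%:R].

Definition hatA (R : realType) (n : nat) (M : mesh R n) tau i : R :=
  hat_grad M tau i 0 0.
Definition hatB (R : realType) (n : nat) (M : mesh R n) tau i : R :=
  hat_grad M tau i 1 0.

Definition Omesh (R : realType) (n : nat) (M : mesh R n) (A : set 'rV[R]_2) :
    set 'I_n :=
  [set k | exists tau,
     [/\ tau \in faces M, k \in tau & hull M tau `&` A !=set0]].

Definition Lmesh (R : realType) (n : nat) (M : mesh R n) (A : set 'rV[R]_2) :
    set 'I_n :=
  [set k | (exists tau,
              [/\ tau \in faces M, k \in tau &
                  interior (hull M tau) `&` A !=set0]) \/
           (exists e,
              [/\ e \in edges M, k \in e & hull M e `&` A !=set0])].

Definition Bmesh (R : realType) (n : nat) (M : mesh R n) (D : set 'rV[R]_2) :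
    set 'I_n :=
  [set k | frontier D (vtx M k)].

Definition joint_family (T : Type) (K J : nat) (X : 'I_K -> set T)
    (Y : 'I_J -> set T) (Z : set T) (i : option ('I_K + 'I_J)) : set T :=
  match i with
  | Some (inl k) => X k
  | Some (inr j) => Y j
  | None => Z
  end.

Definition pairwise_disjoint (T : Type) (K J : nat) (X : 'I_K -> set T)
    (Y : 'I_J -> set T) (Z : set T) : Prop :=
  trivIset [set: option ('I_K + 'I_J)] (joint_family X Y Z).

Definition Imesh (R : realType) (n : nat) (M : mesh R n) (D : set 'rV[R]_2)
    (K J : nat) (Os : 'I_K -> set 'rV[R]_2) (Ls : 'I_J -> set 'rV[R]_2) :
    set 'I_n :=
  [set k | [/\ forall i, ~ Omesh M (Os i) k, forall j, ~ Lmesh M (Ls j) k &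
               ~ Bmesh M D k]].

(* y is a value allowed by the constraints at the vertex k; RL j acts on
   column vectors, hence the transpose. *)
Definition prescribed (R : realType) (n : nat) (M : mesh R n)
    (D : set 'rV[R]_2) (K J : nat)
    (Os : 'I_K -> set 'rV[R]_2) (Ls : 'I_J -> set 'rV[R]_2)
    (rO : R) (RL : 'I_J -> 'M[R]_2)
    (tO : 'I_K -> 'rV[R]_2) (tL : 'I_J -> 'rV[R]_2)
    (g : 'rV[R]_2 -> 'rV[R]_2) (k : 'I_n) (y : 'rV[R]_2) : Prop :=
  [/\ forall i, Omesh M (Os i) k -> y = rO *: vtx M k + tO i,
      forall j, Lmesh M (Ls j) k -> y = vtx M k *m (RL j)^T + tL j &
      Bmesh M D k -> y = g (vtx M k)].

(* A map D -> R^2 is represented by a map on the whole plane, of which only the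
   restriction to D matters. *)
Definition SM (R : realType) (n : nat) (M : mesh R n)
    (D : set 'rV[R]_2) (K J : nat)
    (Os : 'I_K -> set 'rV[R]_2) (Ls : 'I_J -> set 'rV[R]_2)
    (rO : R) (RL : 'I_J -> 'M[R]_2)
    (tO : 'I_K -> 'rV[R]_2) (tL : 'I_J -> 'rV[R]_2)
    (g : 'rV[R]_2 -> 'rV[R]_2) : set ('rV[R]_2 -> 'rV[R]_2) :=
  [set f | [/\ {within D, continuous f},
               forall tau, tau \in faces M -> affine_on (hull M tau) f &
               forall k, prescribed M D Os Ls rO RL tO tL g k (f (vtx M k))]].

Definition frobenius_sq (R : realType) (m p : nat) (G : 'M[R]_(m, p)) : R :=
  \sum_(i < m) \sum_(j < p) G i j ^+ 2.

Definition conformal_energy (R : realType) (n : nat) (M : mesh R n)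
    (area_D2 : R) (f : 'rV[R]_2 -> 'rV[R]_2) : R :=
  - area_D2 +
  2^-1 * \sum_(tau in faces M)
           frobenius_sq (grad_on (hull M tau) f) * area M tau.

Definition is_minimizer (R : realType) (T : Type) (E : T -> R) (S : set T)
    (f : T) : Prop :=
  S f /\ forall h, S h -> E f <= E h.

Definition matrix_form (R : realType) (n : nat) (M : mesh R n)
    (f : 'rV[R]_2 -> 'rV[R]_2) : 'M[R]_(n, 2) :=
  \matrix_(k < n) f (vtx M k).

(* The last nb rows of the matrix form of any element of SM, read off the
   constraints. *)
Definition prescribed_block (R : realType) (ni nb : nat) (M : mesh R (ni + nb))
    (D : set 'rV[R]_2) (K J : nat)
    (Os : 'I_K -> set 'rV[R]_2) (Ls : 'I_J -> set 'rV[R]_2)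
    (rO : R) (RL : 'I_J -> 'M[R]_2)
    (tO : 'I_K -> 'rV[R]_2) (tL : 'I_J -> 'rV[R]_2)
    (g : 'rV[R]_2 -> 'rV[R]_2) : 'M[R]_(nb, 2) :=
  \matrix_(k < nb)
    xget 0 [set y | prescribed M D Os Ls rO RL tO tL g (rshift ni k) y].

Definition Lmatrix (R : realType) (ni nb : nat) (M : mesh R (ni + nb)) :
    'M[R]_(ni, ni + nb) :=
  \matrix_(i0 < ni, j < ni + nb)
    let i := lshift nb i0 in
    if j == i then
      \sum_(tau in faces M | i \in tau)
        area M tau * (hatA M tau i ^+ 2 + hatB M tau i ^+ 2)
    else if [set i; j]%SET \in edges M then
      \sum_(tau in faces M | (i \in tau) && ([set i; j]%SET \subset tau))
        area M tau * (hatA M tau i * hatA M tau j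
                      + hatB M tau i * hatB M tau j)
    else 0.

Definition stieltjes (R : realType) (n : nat) (A : 'M[R]_n) : Prop :=
  [/\ A^T = A,
      forall x : 'cV[R]_n, x != 0 -> 0 < (x^T *m A *m x) 0 0 &
      forall i j, i != j -> A i j <= 0].

(* Main.v *)
(* On each triangle, area * <grad_i, grad_j> is minus half the cotangent of the
   angle opposite to the edge [v_i, v_j]. An edge between two interior vertices
   lies in exactly two triangles, one on each side, and the empty-circle property
   makes the sum of their two cotangents nonnegative; hence the off-diagonal
   entries of L^a are nonpositive. The quadratic form of L^a is the Dirichlet
   energy of the piecewise affine function extended by 0 to the constrained
   vertices: if it vanishes, the function is constant on each triangle, hence
   constant because the rectangle is connected, hence 0 because the corner (0, 0)
   is a constrained vertex. Finally the energy of a competitor with nodal values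
   F + U is E(F) plus the Dirichlet energy of U, the cross term vanishing because
   L F = 0. *)
Require Import Defs.
From HB Require Import structures.
From mathcomp Require Import all_boot all_order all_algebra.
From mathcomp Require Import all_classical all_reals all_analysis.
From mathcomp Require Import ring lra.
Set Implicit Arguments.
Unset Strict Implicit.
Unset Printing Implicit Defensive.
Import Order.TTheory GRing.Theory Num.Theory.
Import numFieldNormedType.Exports.
Local Open Scope classical_set_scope.
Local Open Scope ring_scope.

(** * Barycentric coordinates in a triangle *)

Definition cross (R : realType) (u v : 'rV[R]_2) : R :=
  u 0 0 * v 0 1 - u 0 1 * v 0 0.

Definition dotp (R : realType) (u v : 'rV[R]_2) : R :=
  u 0 0 * v 0 0 + u 0 1 * v 0 1.

Definition nondegenerate (R : realType) (n : nat) (M : mesh R n)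
    (tau : {set 'I_n}) : Prop :=
  #|tau| = 3%N /\ affinely_independent M tau.

Lemma row2P (R : realType) (x y : 'rV[R]_2) :
  x 0 0 = y 0 0 -> x 0 1 = y 0 1 -> x = y.
Proof.
move=> h0 h1; apply/rowP => i; case: i => [[|[|//]] hi].
- by rewrite (_ : Ordinal hi = 0) //; apply/val_inj.
- by rewrite (_ : Ordinal hi = 1) //; apply/val_inj.
Qed.

Lemma coordD (R : realType) (u v : 'rV[R]_2) l : (u + v) 0 l = u 0 l + v 0 l.
Proof. by rewrite mxE. Qed.

Lemma coordN (R : realType) (u : 'rV[R]_2) l : (- u) 0 l = - u 0 l.
Proof. by rewrite mxE. Qed.

Lemma coordZ (R : realType) (p : R) (u : 'rV[R]_2) l :
  (p *: u) 0 l = p * u 0 l.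
Proof. by rewrite mxE. Qed.

Lemma coord0 (R : realType) l : (0 : 'rV[R]_2) 0 l = 0.
Proof. by rewrite mxE. Qed.

(* Rewriting with mxE instead leaves coefficient types that are only convertible
   to R, which ring and field do not identify. *)
Definition coordE := (coordD, coordN, coordZ, coord0).

(** * Three-element index sets *)

Lemma sum_set3 (V : nmodType) (I : finType) (i j k : I) (F : I -> V) :
  i != j -> i != k -> j != k ->
  \sum_(l in [set i; j; k]%SET) F l = F i + F j + F k.
Proof.
move=> ij ik jk; rewrite finset.setUC big_setU1 ?big_setU1 ?big_set1 ?inE //=.
- by rewrite addrC.
- by rewrite negb_or eq_sym ik eq_sym jk.
Qed.

Lemma cards3_pick (I : finType) (A : {set I}) (i j : I) :
  #|A| = 3%N -> i \in A -> j \in A -> i != j ->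
  exists k, [/\ i != k, j != k & A = [set i; j; k]%SET].
Proof.
move=> A3 iA jA ij; have sub : [set i; j]%SET \subset A.
  by apply/fintype.subsetP => x; rewrite !inE => /orP[] /eqP ->.
have : #|A :\: [set i; j]%SET| == 1%N.
  by rewrite cardsD (finset.setIidPr sub) A3 cards2 ij.
case/cards1P => k Ek; exists k.
have : k \in A :\: [set i; j]%SET by rewrite Ek set11.
rewrite !inE negb_or => /andP[/andP[ki kj] kA]; split; rewrite 1?eq_sym //.
by rewrite -Ek -{1}(finset.setID A [set i; j]%SET) (finset.setIidPr sub).
Qed.

Lemma cards3_pick1 (I : finType) (A : {set I}) (i : I) :
  #|A| = 3%N -> i \in A ->
  exists j k, [/\ i != j, i != k, j != k & A = [set i; j; k]%SET].
Proof.
move=> A3 iA; have /card_gt0P[j] : (0 < #|A :\ i|)%N.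
  by move: (cardsD1 i A); rewrite A3 iA add1n => -[<-].
rewrite !inE => /andP[ji jA]; rewrite eq_sym in ji.
by have [k [ik jk AE]] := cards3_pick A3 iA jA ji; exists j, k.
Qed.

Lemma cards3_enum (I : finType) (A : {set I}) :
  #|A| = 3%N ->
  exists i j k, [/\ i != j, i != k, j != k & A = [set i; j; k]%SET].
Proof.
move=> A3; have /card_gt0P[i iA] : (0 < #|A|)%N by rewrite A3.
by exists i; exact: cards3_pick1.
Qed.

(** The left-hand vector is always [cross u v] times [u] turned by a right angle. This gives
    explicit coefficients of a linear dependence, nontrivial as soon as [u] is nonzero. *)
Lemma cross0_dotp (R : realType) (u v : 'rV[R]_2) :
  cross u v = 0 -> dotp u v *: u + (- dotp u u) *: v = 0.
Proof.
rewrite /cross => cr0; apply/row2P; rewrite !coordE /dotp.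
  by rewrite -[RHS](mulr0 (u 0 1)) -cr0; ring.
by rewrite -[RHS](mulr0 (- u 0 0)) -cr0; ring.
Qed.

Lemma dotpp_eq0 (R : realType) (u : 'rV[R]_2) : dotp u u = 0 -> u = 0.
Proof. by rewrite /dotp => uu0; apply/row2P; rewrite coordE; nra. Qed.

Lemma cross_neq0 (R : realType) (n : nat) (M : mesh R n) (i j k : 'I_n) :
  i != j -> i != k -> j != k ->
  affinely_independent M [set i; j; k]%SET ->
  cross (vtx M j - vtx M i) (vtx M k - vtx M i) != 0.
Proof.
move=> ij ik jk ai; apply/eqP => cr0.
set u := vtx M j - vtx M i in cr0; set v := vtx M k - vtx M i in cr0.
(* A linear relation between the two sides becomes an affine one: the weight [- (p + q)] at [i]
   brings the total weight to 0. *)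
pose comb (p q : R) (l : 'I_n) : R :=
  if l == i then - (p + q) else if l == j then p else q.
have combE p q : p *: u + q *: v = 0 -> p = 0 /\ q = 0.
  move=> rel; have := ai (comb p q); rewrite !sum_set3 // /comb eqxx.
  rewrite ![_ == i]eq_sym (negbTE ij) (negbTE ik) eqxx [k == j]eq_sym.
  rewrite (negbTE jk) => h; have {}h : forall l, l \in [set i; j; k]%SET ->
     comb p q l = 0.
    apply: h; first by ring.
    rewrite -[RHS]rel /u /v; apply/row2P; rewrite !coordE; ring.
  split.
    by have := h j; rewrite /comb !inE eqxx orbT [j == i]eq_sym (negbTE ij) => ->.
  have := h k; rewrite /comb !inE eqxx orbT [k == i]eq_sym (negbTE ik).
  by rewrite [k == j]eq_sym (negbTE jk) => ->.
have [|_ /eqP] := combE (dotp u v) (- dotp u u); first exact: cross0_dotp.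
rewrite oppr_eq0 => /eqP/dotpp_eq0 u0.
(* Once [u = 0], the coefficients 1 and 0 also give a relation, which affine independence
   forbids. *)
have [|/eqP] := combE 1 0; last by rewrite oner_eq0.
by rewrite scale0r u0 scaler0 addr0.
Qed.

Lemma affine_span (R : realType) (n : nat) (M : mesh R n) (tau : {set 'I_n})
    (x : 'rV[R]_2) :
  nondegenerate M tau ->
  exists c : 'I_n -> R,
    \sum_(k in tau) c k = 1 /\ x = \sum_(k in tau) c k *: vtx M k.
Proof.
move=> [/cards3_enum [i [j [k [ij ik jk ->]]]] ai].
have := cross_neq0 ij ik jk ai.
set u := vtx M j - vtx M i; set v := vtx M k - vtx M i => D0.
(* Cramer's rule for [x - vtx M i = p *: u + q *: v]. *)
pose p := cross (x - vtx M i) v / cross u v.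
pose q := cross u (x - vtx M i) / cross u v.
exists (fun l => if l == i then 1 - p - q else if l == j then p else q).
rewrite !sum_set3 // eqxx ![_ == i]eq_sym (negbTE ij) (negbTE ik) eqxx.
rewrite [k == j]eq_sym (negbTE jk); split; first by ring.
move: D0; rewrite /p /q /cross /u /v !coordE => D0.
by apply/row2P; rewrite !coordE; field.
Qed.

(** Every point of the plane is an affine combination of the vertices, so agreement at the vertices
    spreads everywhere; the values at 0 and at the basis vectors then recover [c] and the rows of
    [G]. *)
Lemma affine_ext (R : realType) (n m : nat) (M : mesh R n) (tau : {set 'I_n})
    (G G' : 'M[R]_(2, m)) (c c' : 'rV[R]_m) :
  nondegenerate M tau ->
  (forall k, k \in tau -> vtx M k *m G + c = vtx M k *m G' + c') ->
  G = G' /\ c = c'.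
Proof.
move=> nd eqv; have eqx x : x *m G + c = x *m G' + c'.
  have [d [d1 ->]] := affine_span x nd.
  have affE (H : 'M[R]_(2, m)) e : (\sum_(k in tau) d k *: vtx M k) *m H + e =
      \sum_(k in tau) d k *: (vtx M k *m H + e).
    rewrite mulmx_suml -{1}[e]scale1r -d1 scaler_suml -big_split /=.
    by apply: eq_bigr => k _; rewrite scalerDr scalemxAl.
  by rewrite !affE; apply: eq_bigr => k kt; rewrite eqv.
have cc : c = c' by have := eqx 0; rewrite !mul0mx !add0r.
split=> //; apply/row_matrixP => l; rewrite !rowE.
by have := eqx (delta_mx 0 l); rewrite cc => /addIr.
Qed.

(** * Hat functions of a triangle *)

Definition affine_hat (R : realType) (n : nat) (M : mesh R n)
    (tau : {set 'I_n}) (i : 'I_n) (G : 'cV[R]_2) (c : R) : Prop :=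
  forall j, j \in tau -> (vtx M j *m G) 0 0 + c = (j == i)%:R.

Definition hat_cst (R : realType) (n : nat) (M : mesh R n)
    (tau : {set 'I_n}) (i : 'I_n) : R :=
  xget 0 [set c | affine_hat M tau i (hat_grad M tau i) c].

(** On a nondegenerate triangle this is the barycentric coordinate at vertex [i], extended affinely
    to the whole plane; it is identically 0 if [i] is outside [tau]. *)
Definition hat (R : realType) (n : nat) (M : mesh R n) (tau : {set 'I_n})
    (i : 'I_n) (x : 'rV[R]_2) : R :=
  (x *m hat_grad M tau i) 0 0 + hat_cst M tau i.

(* The gradient is the side [v_j, v_k] turned by a right angle, divided by
   twice the signed area. *)
Definition rot_grad (R : realType) (n : nat) (M : mesh R n) (i j k : 'I_n) :
    'cV[R]_2 :=
  \col_l ((if l == 0 then vtx M j 0 1 - vtx M k 0 1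
           else vtx M k 0 0 - vtx M j 0 0)
          / cross (vtx M j - vtx M i) (vtx M k - vtx M i)).

(** Stated as a pair so that a single [rewrite] uses both equations. *)
Lemma rot_gradE (R : realType) (n : nat) (M : mesh R n) (i j k : 'I_n) :
  let D := cross (vtx M j - vtx M i) (vtx M k - vtx M i) in
  (rot_grad M i j k 0 0 = (vtx M j 0 1 - vtx M k 0 1) / D) *
  (rot_grad M i j k 1 0 = (vtx M k 0 0 - vtx M j 0 0) / D).
Proof. by split; rewrite mxE. Qed.

Lemma mul_row2_col2 (R : realType) (x : 'rV[R]_2) (G : 'cV[R]_2) :
  (x *m G) 0 0 = x 0 0 * G 0 0 + x 0 1 * G 1 0.
Proof.
rewrite mxE big_ord_recl big_ord1.
by rewrite (_ : lift ord0 ord0 = 1) //; apply/val_inj.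
Qed.

Lemma rot_gradP (R : realType) (n : nat) (M : mesh R n) (i j k : 'I_n) :
  i != j -> i != k -> j != k -> affinely_independent M [set i; j; k]%SET ->
  affine_hat M [set i; j; k]%SET i (rot_grad M i j k)
    (- (vtx M j *m rot_grad M i j k) 0 0).
Proof.
move=> ij ik jk ai l; have := cross_neq0 ij ik jk ai.
rewrite !inE -orbA !mul_row2_col2 !rot_gradE /cross !coordE => D0.
case/or3P => /eqP ->; rewrite ?eqxx ?[_ == i]eq_sym ?(negbTE ij) ?(negbTE ik) /=.
- by field.
- by field.
- by field.
Qed.

Lemma affine_hat_uniq (R : realType) (n : nat) (M : mesh R n)
    (tau : {set 'I_n}) (i : 'I_n) (G G' : 'cV[R]_2) (c c' : R) :
  nondegenerate M tau ->
  affine_hat M tau i G c -> affine_hat M tau i G' c' -> G = G' /\ c = c'.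
Proof.
move=> nd h h'; have [|GG /(congr1 (fun A : 'rV_1 => A 0 0))] :=
  @affine_ext _ _ 1 M tau G G' (const_mx c) (const_mx c') nd.
- move=> k kt; apply/rowP => l; rewrite !ord1.
  by have := h k kt; have := h' k kt; rewrite !mxE => -> ->.
- by rewrite !mxE.
Qed.

Lemma affine_hat_ex (R : realType) (n : nat) (M : mesh R n)
    (tau : {set 'I_n}) (i : 'I_n) :
  nondegenerate M tau -> exists G c, affine_hat M tau i G c.
Proof.
move=> [t3 ai]; have [it|it] := boolP (i \in tau); last first.
  (* For [i] outside [tau] all the required values are 0. *)
  exists 0, 0 => j jt; rewrite mulmx0 mxE addr0.
  by case: eqP => // ji; rewrite -ji jt in it.
have [j [k [ij ik jk tE]]] := cards3_pick1 t3 it.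
by rewrite tE in ai *; do 2!eexists; exact: rot_gradP.
Qed.

Lemma hatP (R : realType) (n : nat) (M : mesh R n) (tau : {set 'I_n})
    (i : 'I_n) :
  nondegenerate M tau ->
  affine_hat M tau i (hat_grad M tau i) (hat_cst M tau i).
Proof.
move=> nd; have [G [c Gc]] := affine_hat_ex i nd.
have h : exists c', affine_hat M tau i (hat_grad M tau i) c'.
  by rewrite /hat_grad; case: xgetP => [G' _ //|/(_ G) []]; exists c.
rewrite /hat_cst; case: xgetP => [c' _ //|nh].
by case: h => c' /nh.
Qed.

Lemma hat_gradE (R : realType) (n : nat) (M : mesh R n) (i j k : 'I_n) :
  i != j -> i != k -> j != k -> affinely_independent M [set i; j; k]%SET ->
  #|[set i; j; k]%SET| = 3%N ->
  hat_grad M [set i; j; k]%SET i = rot_grad M i j k.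
Proof.
move=> ij ik jk ai t3.
by have [] := affine_hat_uniq (conj t3 ai) (hatP i (conj t3 ai))
  (rot_gradP ij ik jk ai).
Qed.

Lemma hat_vtx (R : realType) (n : nat) (M : mesh R n) (tau : {set 'I_n})
    (i j : 'I_n) :
  nondegenerate M tau -> j \in tau -> hat M tau i (vtx M j) = (j == i)%:R.
Proof. by move=> nd; exact: hatP. Qed.

Lemma hat_affine (R : realType) (n : nat) (M : mesh R n)
    (tau s : {set 'I_n}) (i : 'I_n) (c : 'I_n -> R) :
  \sum_(k in s) c k = 1 ->
  hat M tau i (\sum_(k in s) c k *: vtx M k) =
  \sum_(k in s) c k * hat M tau i (vtx M k).
Proof.
move=> c1; rewrite /hat mulmx_suml summxE -{1}[hat_cst _ _ _]mul1r -c1.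
rewrite mulr_suml -big_split /=; apply: eq_bigr => k _.
by rewrite -scalemxAl mxE mulrDr.
Qed.

(** An affine function commutes with affine combinations, and its values at the vertices are
    Kronecker deltas. Allowing a proper face [s] lets points shared by two triangles be compared. *)
Lemma hat_comb (R : realType) (n : nat) (M : mesh R n)
    (tau s : {set 'I_n}) (i : 'I_n) (c : 'I_n -> R) :
  nondegenerate M tau -> s \subset tau -> \sum_(k in s) c k = 1 ->
  hat M tau i (\sum_(k in s) c k *: vtx M k) = if i \in s then c i else 0.
Proof.
move=> nd /fintype.subsetP st c1; rewrite hat_affine //.
rewrite (eq_bigr (fun k => if k == i then c k else 0)) => [|k ks]; last first.
  by rewrite hat_vtx ?st //; case: eqP => _; rewrite ?mulr1 ?mulr0.
rewrite -big_mkcondr /=; case: ifP => is_.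
  rewrite (eq_bigl (pred1 i)) ?big_pred1_eq // => k /=.
  by case: eqP => [->|]; rewrite ?is_ ?andbF.
by rewrite big_pred0 // => k; case: eqP => [->|]; rewrite ?is_ ?andbF.
Qed.

Lemma hat_span (R : realType) (n : nat) (M : mesh R n) (tau : {set 'I_n})
    (x : 'rV[R]_2) :
  nondegenerate M tau ->
  \sum_(k in tau) hat M tau k x = 1 /\
  x = \sum_(k in tau) hat M tau k x *: vtx M k.
Proof.
move=> nd; have [c [c1 xE]] := affine_span x nd.
have hE k : k \in tau -> hat M tau k x = c k.
  by move=> kt; rewrite xE hat_comb // kt.
by split; [rewrite -[RHS]c1 | rewrite {1}xE]; apply: eq_bigr => k /hE ->.
Qed.

Lemma hull_hat (R : realType) (n : nat) (M : mesh R n) (tau : {set 'I_n})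
    (x : 'rV[R]_2) :
  nondegenerate M tau ->
  hull M tau x <-> forall k, k \in tau -> 0 <= hat M tau k x.
Proof.
move=> nd; split=> [[c [c0 c1 ->]] k kt|h].
  by rewrite hat_comb // kt.
have [s1 sx] := hat_span x nd.
(* [hull] asks for nonnegative weights at every index, so the weights outside [tau] are set to 0. *)
exists (fun k => if k \in tau then hat M tau k x else 0); split.
- by move=> k; case: ifP => // /h.
- by rewrite -[RHS]s1; apply: eq_bigr => k ->.
- by rewrite {1}sx; apply: eq_bigr => k ->.
Qed.

Lemma hat_sub_face (R : realType) (n : nat) (M : mesh R n)
    (tau s : {set 'I_n}) (x : 'rV[R]_2) (k : 'I_n) :
  nondegenerate M tau -> s \subset tau -> hull M s x ->
  hat M tau k x != 0 -> k \in s.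
Proof.
move=> nd st [c [_ c1 ->]]; rewrite hat_comb //.
by case: ifP => //; rewrite eqxx.
Qed.

Lemma hull_vtx (R : realType) (n : nat) (M : mesh R n) (s : {set 'I_n}) k :
  k \in s -> hull M s (vtx M k).
Proof.
move=> ks; exists (fun l => (l == k)%:R); split; first by move=> l; rewrite ler0n.
  by rewrite (bigD1 k) //= eqxx big1 ?addr0 // => l /andP[_ /negbTE ->].
rewrite [RHS](bigD1 k) //= eqxx scale1r big1 ?addr0 // => l /andP[_ /negbTE ->].
by rewrite scale0r.
Qed.

Lemma hull_nonempty (R : realType) (n : nat) (M : mesh R n) (s : {set 'I_n}) x :
  hull M s x -> exists k, k \in s.
Proof.
move=> [c [_ c1 _]]; apply/set0Pn; apply/negP => /eqP s0.
by move: c1; rewrite s0 big_set0 => /eqP; rewrite eq_sym oner_eq0.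
Qed.

Lemma continuous_hat (R : realType) (n : nat) (M : mesh R n)
    (tau : {set 'I_n}) (i : 'I_n) : continuous (hat M tau i).
Proof.
have -> : hat M tau i = (fun y : 'rV[R]_2 => y 0 0 * hat_grad M tau i 0 0 +
     y 0 1 * hat_grad M tau i 1 0 + hat_cst M tau i).
  by apply/funext => y; rewrite /hat mul_row2_col2.
have cM l d : continuous (fun y : 'rV[R]_2 => y 0 l * d).
  move=> y; apply: (@continuousM R _ (fun y : 'rV[R]_2 => y 0 l) (fun=> d)).
    exact: coord_continuous.
  exact: cst_continuous.
move=> x; apply: (@continuousD R R _
  (fun y : 'rV[R]_2 => y 0 0 * hat_grad M tau i 0 0 +
     y 0 1 * hat_grad M tau i 1 0)).
  by apply: continuousD; exact: cM.
exact: cst_continuous.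
Qed.

(** The triangle is an intersection of closed half-planes, one for each barycentric coordinate. *)
Lemma closed_hull (R : realType) (n : nat) (M : mesh R n) (tau : {set 'I_n}) :
  nondegenerate M tau -> closed (hull M tau).
Proof.
move=> nd; have -> : hull M tau =
    \bigcap_(k in [set k | k \in tau]) (hat M tau k @^-1` [set r | 0 <= r]).
  apply/seteqP; split=> x; first by move/(hull_hat x nd).
  by move=> h; apply/(hull_hat x nd) => k /h.
apply: closed_bigI => k _; apply: preimage_closed; last exact: closed_ge.
by move=> x _; exact: continuous_hat.
Qed.

(** [area] reads the vertices in enumeration order, which can be any of six; a change of order
    affects at most the sign of the determinant. *)
Lemma area_triangle (R : realType) (n : nat) (M : mesh R n) (i j k : 'I_n) :
  i != j -> i != k -> j != k ->
  area M [set i; j; k]%SET =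
  `|cross (vtx M j - vtx M i) (vtx M k - vtx M i)| / 2.
Proof.
move=> ij ik jk.
have det2 (u v : 'rV[R]_2) : \det (col_mx u v : 'M[R]_2) = cross u v.
  have mxE0 l : (col_mx u v : 'M[R]_2) 0 l = u 0 l.
    by rewrite -(col_mxEu u v 0 l); congr (col_mx u v _ _); apply/val_inj.
  have mxE1 l : (col_mx u v : 'M[R]_2) 1 l = v 0 l.
    by rewrite -(col_mxEd u v 0 l); congr (col_mx u v _ _); apply/val_inj.
  have l1 : lift ord0 ord0 = 1 :> 'I_2 by apply/val_inj.
  have l0 : lift 1 ord0 = 0 :> 'I_2 by apply/val_inj.
  have minor l : row' 0 (col' l (col_mx u v : 'M[R]_2)) 0 0 = v 0 (lift l 0).
    by rewrite -mxE1 [LHS]mxE [LHS]mxE l1.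
  rewrite (expand_det_row _ 0) big_ord_recl big_ord1 /cofactor !det_mx11 l1.
  rewrite !mxE0 !minor l1 l0 /cross /= expr0 expr1; ring.
set tau := [set i; j; k]%SET.
have size3 : size (enum tau) = 3%N.
  rewrite -cardE /tau finset.setUC cardsU1 !inE cards2 ij negb_or.
  by rewrite eq_sym ik eq_sym jk.
have uniq3 : uniq (enum tau) by exact: enum_uniq.
have mem3 l : l \in tau -> l \in enum tau by rewrite mem_enum.
rewrite /area det2 /image_mem; move: size3 uniq3 mem3.
case: (enum tau) => [|x [|y [|z [|]]]] //= _; rewrite !inE.
rewrite negb_or andbT => /andP[/andP[xy xz] yz] mem3.
have := mem3 k; have := mem3 j; have {mem3} := mem3 i.
rewrite /tau !inE !eqxx ?orbT /= => /(_ isT) hi /(_ isT) hj /(_ isT) hk.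
congr (_ / 2); move: ij ik jk.
case/or3P: hi => /eqP ->; case/or3P: hj => /eqP ->; case/or3P: hk => /eqP ->;
  rewrite ?eqxx // => _ _ _; rewrite /cross !coordE;
  first [by congr (`|_|); ring | by rewrite -[LHS]normrN; congr (`|_|); ring].
Qed.

(** * Cotangents and the empty-circle property *)

Lemma triangle_rotl (I : finType) (i j k : I) :
  [set i; j; k]%SET = [set k; i; j]%SET.
Proof. by apply/setP => x; rewrite !inE orbC orbA. Qed.

Lemma triangle_swap (I : finType) (i j k : I) :
  [set i; j; k]%SET = [set j; i; k]%SET.
Proof. by rewrite [[set i; j]%SET]finset.setUC. Qed.

Lemma cross_cycle (R : realType) (x y z : 'rV[R]_2) :
  cross (y - x) (z - x) = cross (x - z) (y - z).
Proof. by rewrite /cross !coordE; ring. Qed.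

(** The gradients are sides turned by a right angle and divided by plus or minus twice the area, and
    the rotation preserves inner products. The result is minus half the cotangent of the angle at
    [k]. *)
Lemma area_hat_dot (R : realType) (n : nat) (M : mesh R n) (i j k : 'I_n) :
  i != j -> i != k -> j != k ->
  nondegenerate M [set i; j; k]%SET ->
  let tau := [set i; j; k]%SET in
  let u := vtx M i - vtx M k in let v := vtx M j - vtx M k in
  area M tau * (hatA M tau i * hatA M tau j + hatB M tau i * hatB M tau j) =
  - (dotp u v / (2 * `|cross u v|)).
Proof.
move=> ij ik jk [t3 ai] tau u v; rewrite /tau /hatA /hatB area_triangle //.
rewrite hat_gradE // /u /v -(cross_cycle (vtx M i)).
have -> : hat_grad M [set i; j; k]%SET j = rot_grad M j i k.
  by rewrite triangle_swap hat_gradE -1?triangle_swap // eq_sym.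
have D0 := cross_neq0 ij ik jk ai; rewrite !rot_gradE.
have -> : cross (vtx M i - vtx M j) (vtx M k - vtx M j) =
    - cross (vtx M j - vtx M i) (vtx M k - vtx M i).
  by rewrite /cross !coordE; ring.
set D := cross _ _ in D0 *; rewrite /dotp !coordE.
have D1 := D0; by case: (ltrgt0P D) D1 => // [D_gt0|D_lt0] _; field.
Qed.

(** A barycentric coordinate is a ratio of signed areas, [x] replacing the vertex [k]; its sign
    tells on which side of the line through [vtx M i] and [vtx M j] the point lies. *)
Lemma hat_cross (R : realType) (n : nat) (M : mesh R n) (i j k : 'I_n) x :
  i != j -> i != k -> j != k ->
  nondegenerate M [set i; j; k]%SET ->
  hat M [set i; j; k]%SET k x =
  cross (vtx M i - x) (vtx M j - x) /
  cross (vtx M i - vtx M k) (vtx M j - vtx M k).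
Proof.
move=> ij ik jk nd; have := hat_vtx k nd (_ : i \in _).
rewrite !inE eqxx => /(_ isT); rewrite (negbTE ik) mulr0n => hi.
(* Subtracting the zero value at [vtx M i] eliminates the constant term of the hat function. *)
rewrite -[LHS]subr0 -hi /hat; move: nd; rewrite triangle_rotl => -[t3 ai].
have ki : k != i by rewrite eq_sym.
have kj : k != j by rewrite eq_sym.
rewrite hat_gradE //; have := cross_neq0 ki kj ij ai.
rewrite !mul_row2_col2 !rot_gradE; set D := cross _ _; rewrite /cross !coordE.
by move=> D0; field.
Qed.

Lemma edistE (R : realType) (x y : 'rV[R]_2) :
  Defs.edist x y = Num.sqrt ((x 0 0 - y 0 0) ^+ 2 + (x 0 1 - y 0 1) ^+ 2).
Proof.
rewrite /Defs.edist big_ord_recl big_ord1.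
by rewrite (_ : lift ord0 ord0 = 1) //; apply/val_inj.
Qed.

(* The circumcentre of p, q, k is the midpoint of [p, q] shifted by half the
   cotangent of the angle at k along the normal; the power of l with respect to
   the circumcircle is the cotangent sum multiplied by |cross (p - l) (q - l)|. *)
Lemma cot_sum_ge0 (R : realType) (p q k l : 'rV[R]_2) :
  cross (p - k) (q - k) * cross (p - l) (q - l) < 0 ->
  (forall c r, Defs.edist c p = r -> Defs.edist c q = r -> Defs.edist c k = r ->
     r <= Defs.edist c l) ->
  0 <= dotp (p - k) (q - k) / `|cross (p - k) (q - k)| +
       dotp (p - l) (q - l) / `|cross (p - l) (q - l)|.
Proof.
set D := cross (p - k) _; set Dl := cross (p - l) _ => DDl delaunay_l.
have D0 : D != 0 by apply: contraTneq DDl => ->; rewrite mul0r ltxx.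
have Dl0 : Dl != 0 by apply: contraTneq DDl => ->; rewrite mulr0 ltxx.
pose s := dotp (p - k) (q - k) / (2 * D).
pose c : 'rV[R]_2 := pt ((p 0 0 + q 0 0) / 2 - s * (q 0 1 - p 0 1))
                        ((p 0 1 + q 0 1) / 2 + s * (q 0 0 - p 0 0)).
have c0 : c 0 0 = (p 0 0 + q 0 0) / 2 - s * (q 0 1 - p 0 1) by rewrite mxE.
have c1 : c 0 1 = (p 0 1 + q 0 1) / 2 + s * (q 0 0 - p 0 0) by rewrite mxE.
pose power (z : 'rV[R]_2) := (c 0 0 - z 0 0) ^+ 2 + (c 0 1 - z 0 1) ^+ 2.
have powerE z : power z = power p +
    (dotp (p - z) (q - z) - 2 * s * cross (p - z) (q - z)).
  by rewrite /power c0 c1 /dotp /cross !coordE; field.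
have power_q : power q = power p.
  by rewrite powerE /dotp /cross !coordE; ring.
have power_k : power k = power p.
  by rewrite powerE -/D /s; field.
have power_l : power p <= power l.
  have := delaunay_l c _ erefl; rewrite !edistE -!/(power _) power_q power_k.
  move=> /(_ erefl erefl); rewrite ler_sqrt //.
  by rewrite /power addr_ge0 // sqr_ge0.
have {power_l} : 0 <= dotp (p - l) (q - l) - dotp (p - k) (q - k) * Dl / D.
  move: power_l; rewrite (powerE l) -/Dl lerDl /s => le.
  by apply: (le_trans le); rewrite le_eqVlt; apply/orP; left; apply/eqP; field.
(* [D] and [Dl] have opposite signs, so dividing [Dl / D] by the absolute value of [Dl] leaves minus
   the inverse of the absolute value of [D]. *)
move=> h; have -> : dotp (p - k) (q - k) / `|D| + dotp (p - l) (q - l) / `|Dl| =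
    (dotp (p - l) (q - l) - dotp (p - k) (q - k) * Dl / D) / `|Dl|.
  have /orP[Dp|Dn] : (0 < D) || (D < 0) by rewrite -neq_lt eq_sym.
    move: DDl; rewrite pmulr_rlt0 // => Dln.
    by rewrite gtr0_norm // ltr0_norm //; field; rewrite D0 Dl0.
  move: DDl; rewrite nmulr_rlt0 // => Dln.
  by rewrite ltr0_norm // gtr0_norm //; field; rewrite D0 Dl0.
by rewrite divr_ge0.
Qed.

(** * The two triangles adjacent to an interior edge *)

Lemma continuous_line (R : realType) (x d : 'rV[R]_2) :
  continuous (fun t : R => x + t *: d).
Proof.
move=> t; apply: (@continuousD R 'rV[R]_2 R (fun=> x) (fun t => t *: d) t).
  exact: cst_continuous.
exact: scalel_continuous.
Qed.

Lemma near_line (R : realType) (x d : 'rV[R]_2) (U : set 'rV[R]_2) :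
  nbhs x U -> \forall t \near (0 : R)^'+, U (x + t *: d).
Proof.
move=> xU; have nearU : nbhs (0 : R) ((fun t => x + t *: d) @^-1` U).
  by apply: continuous_line; rewrite scale0r addr0.
exact: (cvg_within _ nearU).
Qed.

Definition segment_convex (R : realType) (D : set 'rV[R]_2) : Prop :=
  forall x y t, 0 <= t <= 1 -> D x -> D y -> D (x + t *: (y - x)).

Lemma hull_sum2 (R : realType) (n : nat) (M : mesh R n) (s : {set 'I_n})
    (p q : R) (x y : 'rV[R]_2) :
  0 <= p -> 0 <= q -> p + q = 1 -> hull M s x -> hull M s y ->
  hull M s (p *: x + q *: y).
Proof.
move=> p0 q0 pq [c [c0 c1 ->]] [d [d0 d1 ->]].
exists (fun k => p * c k + q * d k); split.
- by move=> k; rewrite addr_ge0 // mulr_ge0.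
- by rewrite big_split /= -!mulr_sumr c1 d1 !mulr1.
- rewrite !scaler_sumr -big_split /=; apply: eq_bigr => k _.
  by rewrite !scalerA -scalerDl.
Qed.

Lemma hat_line (R : realType) (n : nat) (M : mesh R n) (tau : {set 'I_n})
    (k : 'I_n) (p q : R) (x y : 'rV[R]_2) :
  p + q = 1 ->
  hat M tau k (p *: x + q *: y) = p * hat M tau k x + q * hat M tau k y.
Proof.
move=> pq; rewrite /hat mulmxDl -!scalemxAl [X in X + _]mxE !mxE.
by rewrite -[X in _ + X = _]mul1r -pq; ring.
Qed.

(** There are finitely many triangles and each is closed, so those missing [x] also miss a common
    neighbourhood of [x]. *)
Lemma near_notin_hulls (R : realType) (n : nat) (M : mesh R n) (x : 'rV[R]_2) :
  (forall tau, tau \in faces M -> nondegenerate M tau) ->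
  \forall y \near x, forall tau, tau \in faces M -> hull M tau y -> hull M tau x.
Proof.
move=> nd; apply: (@filter_forall _ _
  (fun tau y => tau \in faces M -> hull M tau y -> hull M tau x) (nbhs x) _).
move=> tau.
have [tauF|tauF] := boolP (tau \in faces M); last by apply: nearW.
have [hx|hx] := pselect (hull M tau x); first by apply: nearW.
have : nbhs x (~` hull M tau).
  apply: open_nbhs_nbhs; split=> //; apply: closed_openC.
  by apply: closed_hull; exact: nd.
by apply: filterS => y ny _ /ny.
Qed.

(** Push the midpoint [m] of the edge slightly beyond it, away from [vtx M k]. A triangle covering
    the new point also contains [m] if the push is small, hence contains the whole edge, and its
    third vertex must lie beyond the edge. *)
Lemma opposite_triangle (R : realType) (n : nat) (M : mesh R n)
    (D : set 'rV[R]_2) (i j k : 'I_n) :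
  triangulation_of M D ->
  segment_convex D ->
  interior D (vtx M i) -> interior D (vtx M j) ->
  i != j -> i != k -> j != k -> [set i; j; k]%SET \in faces M ->
  exists l, [/\ i != l, j != l, [set i; j; l]%SET \in faces M &
    hat M [set i; j; k]%SET k (vtx M l) < 0].
Proof.
move=> [_ nd _ meet supp] Dcvx Di Dj ij ik jk sF.
have nds := nd _ sF; set sigma := [set i; j; k]%SET in sF nds *.
pose m := 2^-1 *: vtx M i + 2^-1 *: vtx M j.
pose d := m - vtx M k.
have half : 2^-1 + 2^-1 = 1 :> R by field.
have : \forall t \near (0 : R)^'+, [/\ 0 < t, D (vtx M i + t *: d),
    D (vtx M j + t *: d) &
    forall tau, tau \in faces M -> hull M tau (m + t *: d) -> hull M tau m].
  near=> t; split; near: t.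
  - exact: nbhs_right_gt.
  - exact: near_line.
  - exact: near_line.
  - apply: (near_line d (U := fun y => forall tau, tau \in faces M ->
      hull M tau y -> hull M tau m)).
    exact: near_notin_hulls.
move=> /filter_ex [t [t0 Dit Djt out]].
(* The pushed point is the midpoint of the two pushed endpoints, which stay in [D] because the
   endpoints are interior. *)
have : D (m + t *: d).
  have -> : m + t *: d = (vtx M i + t *: d) +
      2^-1 *: ((vtx M j + t *: d) - (vtx M i + t *: d)).
    by apply/row2P; rewrite /m !coordE; field.
  by apply: Dcvx => //; rewrite invr_ge0 ler0n invf_le1 ?ler1n.
rewrite -supp => -[tau tF tx]; have ndt := nd _ tF.
have sm : hull M sigma m.
  by apply: hull_sum2 => //; rewrite ?invr_ge0 //; apply: hull_vtx;
    rewrite !inE eqxx ?orbT.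
have : hull M (sigma :&: tau) m by rewrite -meet //; split=> //; exact: out.
move=> mI.
have hm h : hat M sigma h m = 2^-1 * (i == h)%:R + 2^-1 * (j == h)%:R.
  by rewrite hat_line // !hat_vtx // !inE eqxx ?orbT.
have it : i \in tau.
  have /finset.setIP[] // : i \in (sigma :&: tau)%SET.
  apply: (hat_sub_face nds _ mI); first exact: finset.subsetIl.
  by rewrite hm eqxx [j == i]eq_sym (negbTE ij) mulr0 addr0 mulr1
    invr_eq0 pnatr_eq0.
have jt : j \in tau.
  have /finset.setIP[] // : j \in (sigma :&: tau)%SET.
  apply: (hat_sub_face nds _ mI); first exact: finset.subsetIl.
  by rewrite hm eqxx (negbTE ij) mulr0 add0r mulr1 invr_eq0 pnatr_eq0.
have [l [il jl tE]] := cards3_pick (proj1 ndt) it jt ij.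
exists l; split=> //; first by rewrite -tE.
have [s1 xE] := hat_span (m + t *: d) ndt.
(* The pushed point divides the line through [m] and [vtx M k] with weights [1 + t] and [- t]. *)
have hx : hat M sigma k (m + t *: d) = - t.
  have -> : m + t *: d = (1 + t) *: m + (- t) *: vtx M k.
    by apply/row2P; rewrite /d !coordE; ring.
  rewrite hat_line; last by ring.
  rewrite hm (negbTE ik) (negbTE jk) hat_vtx // ?eqxx; last first.
    by rewrite !inE eqxx orbT.
  by rewrite /=; ring.
have /(hull_hat _ ndt)/(_ l) := tx.
rewrite {1}tE !inE eqxx orbT => /(_ isT) hl.
have ki : hat M sigma k (vtx M i) = 0.
  by rewrite hat_vtx ?inE ?eqxx // (negbTE ik).
have kj : hat M sigma k (vtx M j) = 0.
  by rewrite hat_vtx ?inE ?eqxx ?orbT // (negbTE jk).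
(* The coordinate at [k] vanishes at both endpoints, so [- t] is the nonnegative weight of [vtx M l]
   times the coordinate of [vtx M l] at [k]. *)
move: hx; rewrite xE hat_affine // {1}tE sum_set3 // ki kj !mulr0 !add0r => pq.
rewrite ltNge; apply/negP => q0.
by have := mulr_ge0 hl q0; rewrite pq oppr_ge0 leNgt t0.
Unshelve. all: by end_near.
Qed.

(** A point [y] near the midpoint of the edge, moved towards [vtx M l], lies in both triangles,
    hence in their common face. Its coordinate at [k] is positive, so [k] is a vertex of that
    face. *)
Lemma same_side_triangle (R : realType) (n : nat) (M : mesh R n)
    (D : set 'rV[R]_2) (i j k l : 'I_n) :
  triangulation_of M D ->
  i != j -> i != k -> j != k -> [set i; j; k]%SET \in faces M ->
  i != l -> j != l -> [set i; j; l]%SET \in faces M ->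
  0 < hat M [set i; j; k]%SET k (vtx M l) -> k = l.
Proof.
move=> [_ nd _ meet _] ij ik jk sF il jl tF lk_gt0; apply/eqP; apply: contraT => kl.
have nds := nd _ sF; have ndt := nd _ tF.
set sigma := [set i; j; k]%SET in sF nds lk_gt0 *.
set tau := [set i; j; l]%SET in tF ndt *.
have half : 2^-1 + 2^-1 = 1 :> R by field.
pose m := 2^-1 *: vtx M i + 2^-1 *: vtx M j.
pose A := hat M sigma i (vtx M l); pose B := hat M sigma j (vtx M l).
(* Small enough that the coordinates of [y] at [i] and [j], namely [(1 - t) / 2 + t * A] and
   [(1 - t) / 2 + t * B], remain nonnegative. *)
pose t := (1 + 2 * `|A| + 2 * `|B|)^-1.
have den_gt0 : 0 < 1 + 2 * `|A| + 2 * `|B|.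
  by have := normr_ge0 A; have := normr_ge0 B; lra.
have t_gt0 : 0 < t by rewrite invr_gt0.
have tE : t * (1 + 2 * `|A| + 2 * `|B|) = 1 by rewrite mulVf // gt_eqF.
have tA : t * `|A| >= 0 by rewrite mulr_ge0 // ltW.
have tB : t * `|B| >= 0 by rewrite mulr_ge0 // ltW.
pose y := (1 - t) *: m + t *: vtx M l.
have mh (h : 'I_n) (rho : {set 'I_n}) : nondegenerate M rho ->
    i \in rho -> j \in rho ->
    hat M rho h m = 2^-1 * (i == h)%:R + 2^-1 * (j == h)%:R.
  by move=> ndr ir jr; rewrite hat_line // !hat_vtx.
have ty : hull M tau y.
  apply: hull_sum2; rewrite ?subrK ?(ltW t_gt0) //.
  - by rewrite subr_ge0; lra.
  - by apply: hull_sum2 => //; rewrite ?invr_ge0 //; apply: hull_vtx;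
      rewrite !inE eqxx ?orbT.
  - by apply: hull_vtx; rewrite !inE eqxx orbT.
have hy h : hat M sigma h y = (1 - t) * (2^-1 * (i == h)%:R + 2^-1 * (j == h)%:R)
    + t * hat M sigma h (vtx M l).
  by rewrite hat_line ?subrK // mh // !inE eqxx ?orbT.
have hky : 0 < hat M sigma k y.
  by rewrite hy (negbTE ik) (negbTE jk) /= !mulr0 addr0 mulr0 add0r mulr_gt0.
have sy : hull M sigma y.
  apply/(hull_hat _ nds) => h; rewrite !inE -orbA => /or3P[] /eqP ->.
  - rewrite hy eqxx [j == i]eq_sym (negbTE ij) /= -/A.
    have := ler_norm (- A); rewrite normrN => hA.
    have : t * (- A) <= t * `|A| by rewrite ler_pM2l.
    by nra.
  - rewrite hy eqxx (negbTE ij) /= -/B.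
    have := ler_norm (- B); rewrite normrN => hB.
    have : t * (- B) <= t * `|B| by rewrite ler_pM2l.
    by nra.
  - exact: ltW.
have yI : hull M (sigma :&: tau) y by rewrite -meet.
have : k \in (sigma :&: tau)%SET.
  apply: (hat_sub_face nds _ yI); first exact: finset.subsetIl.
  by rewrite gt_eqF.
by rewrite !inE (negbTE kl) ![k == _]eq_sym (negbTE ik) (negbTE jk) andbF.
Qed.

(** * The stiffness matrix *)

(** The full square matrix whose first [ni] rows form [Lmatrix]. Summing over all triangles, without
    an incidence condition, makes it symmetric at sight and bilinear in the gradients. *)
Definition stiffness (R : realType) (n : nat) (M : mesh R n) (i j : 'I_n) : R :=
  \sum_(tau in faces M)
    area M tau * (hatA M tau i * hatA M tau j + hatB M tau i * hatB M tau j).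

Lemma hat_grad_out (R : realType) (n : nat) (M : mesh R n) (tau : {set 'I_n})
    (i : 'I_n) :
  nondegenerate M tau -> i \notin tau -> hat_grad M tau i = 0.
Proof.
move=> nd it; have h0 : affine_hat M tau i 0 0.
  move=> j jt; rewrite mulmx0 mxE addr0.
  by case: eqP => // ji; rewrite -ji jt in it.
by have [] := affine_hat_uniq nd (hatP i nd) h0.
Qed.

Lemma stiffnessC (R : realType) (n : nat) (M : mesh R n) (i j : 'I_n) :
  stiffness M i j = stiffness M j i.
Proof. by apply: eq_bigr => tau _; congr (_ * _); ring. Qed.

Lemma stiffness_edge (R : realType) (n : nat) (M : mesh R n) (i j : 'I_n) :
  (forall tau, tau \in faces M -> nondegenerate M tau) ->
  stiffness M i j = \sum_(tau in faces M | (i \in tau) && (j \in tau))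
    area M tau * (hatA M tau i * hatA M tau j + hatB M tau i * hatB M tau j).
Proof.
move=> nd; rewrite /stiffness [RHS]big_mkcondr; apply: eq_bigr => tau /nd ndt.
rewrite /hatA /hatB; case: ifPn => //; rewrite negb_and.
by move=> /orP[] /(hat_grad_out ndt) ->;
  rewrite !mxE ?mul0r ?mulr0 addr0 mulr0.
Qed.

Lemma Lmatrix_stiffness (R : realType) (ni nb : nat) (M : mesh R (ni + nb)) i j :
  (forall tau, tau \in faces M -> nondegenerate M tau) ->
  Lmatrix M i j = stiffness M (lshift nb i) j.
Proof.
move=> nd; rewrite stiffness_edge // mxE /=.
case: eqP => [->|/eqP ji].
  by under [RHS]eq_bigl do rewrite andbb.
case: ifPn => [_|]; last first.
  rewrite inE cards2 [_ == j]eq_sym ji /= => /negP noface.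
  rewrite big_pred0 // => tau; apply/negbTE/negP => /and3P[tF it jt].
  apply: noface; apply/existsP; exists tau; rewrite tF /=.
  by apply/fintype.subsetP => x; rewrite !inE => /orP[] /eqP ->.
apply: eq_bigl => tau; congr (_ && _).
rewrite finset.subUset !finset.sub1set; by case: (_ \in tau).
Qed.

(** [opposite_triangle] supplies a second triangle on the edge and [same_side_triangle] excludes a
    third, so the sum reduces to the two cotangents handled by [cot_sum_ge0]. *)
Lemma stiffness_le0 (R : realType) (n : nat) (M : mesh R n)
    (D : set 'rV[R]_2) (i j : 'I_n) :
  triangulation_of M D -> delaunay M ->
  segment_convex D ->
  interior D (vtx M i) -> interior D (vtx M j) -> i != j ->
  stiffness M i j <= 0.
Proof.
move=> tri del Dcvx Di Dj ij; have [_ nd _ _ _] := tri.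
rewrite stiffness_edge //.
have [sigma /and3P[sF is_ js]|none] :=
  pickP (fun tau => [&& tau \in faces M, i \in tau & j \in tau]); last first.
  by rewrite big_pred0.
have [k [ik jk sE]] := cards3_pick (proj1 (nd _ sF)) is_ js ij.
rewrite {}sE in sF is_ js *.
have [l [il jl tF lneg]] := opposite_triangle tri Dcvx Di Dj ij ik jk sF.
(* The sign of [X h] records the side of the edge on which [vtx M h] lies. *)
pose X h := cross (vtx M i - vtx M h) (vtx M j - vtx M h).
have hatX h x : i != h -> j != h -> [set i; j; h]%SET \in faces M ->
    hat M [set i; j; h]%SET h (vtx M x) = X x / X h.
  by move=> ih jh /nd ndh; rewrite hat_cross.
have X0 h : i != h -> j != h -> [set i; j; h]%SET \in faces M -> X h != 0.
  by move=> ih jh /nd [_ ai]; rewrite /X -cross_cycle cross_neq0.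
have Xk0 := X0 _ ik jk sF; have Xl0 := X0 _ il jl tF.
move: (lneg); rewrite hatX // => Xlk.
have kl : [set i; j; l]%SET != [set i; j; k]%SET.
  apply: contraTneq lneg => tsE.
  have : l \in [set i; j; k]%SET by rewrite -tsE !inE eqxx orbT.
  rewrite !inE ![l == _]eq_sym (negbTE il) (negbTE jl) /= => /eqP <-.
  by rewrite hatX // divff // ltr10.
rewrite (bigD1 [set i; j; k]%SET) /=; last by rewrite sF is_ js.
rewrite (bigD1 [set i; j; l]%SET) /=; last first.
  by rewrite tF kl !inE !eqxx !orbT.
rewrite big1 => [|rho]; last first.
  move=> /andP[/andP[/and3P[rF ir jr] rs] rt]; exfalso.
  have [h [ih jh rE]] := cards3_pick (proj1 (nd _ rF)) ir jr ij.
  rewrite {}rE in rF rs rt.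
  have Xh0 := X0 _ ih jh rF.
  have Xhk0 : X h / X k != 0 by rewrite mulf_neq0 // invr_eq0.
  have /orP[Xhk|Xhk] : (0 < X h / X k) || (X h / X k < 0).
    by rewrite -neq_lt eq_sym.
    have kh : k = h by apply: (same_side_triangle tri ij ik jk sF) => //; rewrite hatX.
    by rewrite kh eqxx in rs.
  have lh : l = h.
    apply: (same_side_triangle tri ij il jl tF) => //; rewrite hatX //.
    (* Both [h] and [l] lie opposite to [k], hence on the same side. *)
    have -> : X h / X l = (X h / X k) / (X l / X k) by field; rewrite Xk0 Xl0.
    by rewrite nmulr_rgt0 // invr_lt0.
  by rewrite lh eqxx in rt.
rewrite addr0 !area_hat_dot //; try exact: nd.
have /cot_sum_ge0 : X k * X l < 0.
  have -> : X k * X l = (X l / X k) * X k ^+ 2 by field.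
  by rewrite pmulr_llt0 // exprn_even_gt0.
rewrite -/(X k) -/(X l) => cot_ge0.
have {}cot_ge0 := cot_ge0 _.
have half (p q : R) : p / (2 * q) = 2^-1 * (p / q) by rewrite invfM mulrCA.
rewrite !half -opprD oppr_le0 -mulrDr mulr_ge0 ?invr_ge0 //.
apply: cot_ge0 => c r ci cj ck.
apply: (del _ sF) => h; rewrite !inE -orbA => /or3P[] /eqP -> //.
Qed.

(** * The Dirichlet form *)

(** The gradient on [tau] of the piecewise affine function with nodal values [x]; on a nondegenerate
    triangle the vertices outside [tau] contribute 0. *)
Definition pl_grad (R : realType) (n : nat) (M : mesh R n) (tau : {set 'I_n})
    (x : 'I_n -> R) : 'cV[R]_2 :=
  \sum_k x k *: hat_grad M tau k.

Definition dirichlet (R : realType) (n : nat) (M : mesh R n)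
    (x y : 'I_n -> R) : R :=
  \sum_(tau in faces M) area M tau *
    (pl_grad M tau x 0 0 * pl_grad M tau y 0 0 +
     pl_grad M tau x 1 0 * pl_grad M tau y 1 0).

Lemma dirichletE (R : realType) (n : nat) (M : mesh R n) (x y : 'I_n -> R) :
  dirichlet M x y = \sum_i x i * \sum_j stiffness M i j * y j.
Proof.
under [RHS]eq_bigr => i _.
  rewrite mulr_sumr; under eq_bigr => j _ do
    rewrite /stiffness mulr_suml mulr_sumr.
  over.
under [RHS]eq_bigr => i _ do rewrite exchange_big /=.
rewrite [RHS]exchange_big /=; apply: eq_bigr => tau _.
rewrite /pl_grad !summxE mulrDr !mulr_suml !mulr_sumr -big_split /=.
apply: eq_bigr => i _; rewrite !mulr_sumr -big_split /=.
apply: eq_bigr => j _; rewrite /hatA /hatB.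
have colZ (p : R) (G : 'cV[R]_2) l : (p *: G) l 0 = p * G l 0 by rewrite mxE.
by rewrite !colZ; ring.
Qed.

Lemma dirichletC (R : realType) (n : nat) (M : mesh R n) (x y : 'I_n -> R) :
  dirichlet M x y = dirichlet M y x.
Proof. by apply: eq_bigr => tau _; congr (_ * _); ring. Qed.

Lemma dirichletD (R : realType) (n : nat) (M : mesh R n) (x y z : 'I_n -> R) :
  dirichlet M (fun k => x k + y k) z = dirichlet M x z + dirichlet M y z.
Proof.
by rewrite !dirichletE -big_split /=; apply: eq_bigr => i _; rewrite mulrDl.
Qed.

Lemma area_gt0 (R : realType) (n : nat) (M : mesh R n) (tau : {set 'I_n}) :
  nondegenerate M tau -> 0 < area M tau.
Proof.
move=> [/cards3_enum [i [j [k [ij ik jk ->]]]] ai].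
by rewrite area_triangle // divr_gt0 // normr_gt0 cross_neq0.
Qed.

Lemma dirichlet_ge0 (R : realType) (n : nat) (M : mesh R n) (x : 'I_n -> R) :
  (forall tau, tau \in faces M -> nondegenerate M tau) -> 0 <= dirichlet M x x.
Proof.
move=> nd; apply: sumr_ge0 => tau /nd ndt.
by rewrite mulr_ge0 ?(ltW (area_gt0 ndt)) // -!expr2 addr_ge0 // sqr_ge0.
Qed.

Lemma pl_gradP (R : realType) (n : nat) (M : mesh R n) (tau : {set 'I_n})
    (x : 'I_n -> R) i :
  nondegenerate M tau -> i \in tau ->
  (vtx M i *m pl_grad M tau x) 0 0 + \sum_k x k * hat_cst M tau k = x i.
Proof.
move=> nd it; rewrite /pl_grad mulmx_sumr summxE -big_split /=.
rewrite (bigD1 i) //= big1 => [|k ki].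
  by rewrite -scalemxAr mxE -mulrDr (hatP i nd it) eqxx mulr1 addr0.
by rewrite -scalemxAr mxE -mulrDr (hatP k nd it) eq_sym (negbTE ki) mulr0.
Qed.

(** Each summand is a positive area times a squared norm, so every gradient vanishes. *)
Lemma dirichlet_eq0 (R : realType) (n : nat) (M : mesh R n) (x : 'I_n -> R) :
  (forall tau, tau \in faces M -> nondegenerate M tau) -> dirichlet M x x = 0 ->
  forall tau i j, tau \in faces M -> i \in tau -> j \in tau -> x i = x j.
Proof.
move=> nd /eqP; rewrite psumr_eq0 => [/allP h tau i j tF it jt|tau /nd ndt].
  have := h tau (mem_index_enum _); rewrite tF /= mulf_eq0.
  rewrite gt_eqF ?(area_gt0 (nd _ tF)) //= -!expr2 paddr_eq0 ?sqr_ge0 //.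
  rewrite !sqrf_eq0 => /andP[/eqP g0 /eqP g1].
  rewrite -(pl_gradP x (nd _ tF) it) -(pl_gradP x (nd _ tF) jt).
  by rewrite !mul_row2_col2 g0 g1 !mulr0.
by rewrite mulr_ge0 ?(ltW (area_gt0 ndt)) // -!expr2 addr_ge0 // sqr_ge0.
Qed.

(* The triangles on which x is equal to x i cover a closed subset of the segment
   [v_i, v_j], and so do the other triangles; two triangles sharing a point share
   a vertex, so these two closed sets are disjoint. *)
Lemma face_constant (R : realType) (n : nat) (M : mesh R n)
    (D : set 'rV[R]_2) (x : 'I_n -> R) :
  triangulation_of M D -> segment_convex D ->
  (forall tau i j, tau \in faces M -> i \in tau -> j \in tau -> x i = x j) ->
  forall i j, x i = x j.
Proof.
move=> [_ nd inface meet supp] Dcvx xface i j.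
have Dv k : D (vtx M k).
  have [tau tF kt] := inface k; rewrite -supp; exists tau => //.
  exact: hull_vtx.
pose p (t : R) : 'rV[R]_2 := vtx M i + t *: (vtx M j - vtx M i).
pose on (P : pred R) : set 'rV[R]_2 :=
  \bigcup_(tau in [set tau | (tau \in faces M) && [forall k in tau, P (x k)]])
    hull M tau.
have on_closed P : closed (p @^-1` on P).
  apply: preimage_closed; first by move=> t _; exact: continuous_line.
  apply: closed_bigcup; first exact: finite_finset.
  by move=> tau /andP[/nd ndt _]; exact: closed_hull.
have hullI sigma tau y : sigma \in faces M -> tau \in faces M ->
    hull M sigma y -> hull M tau y -> exists2 k, k \in sigma & k \in tau.
  move=> sF tF sy ty; have : hull M (sigma :&: tau) y by rewrite -meet.
  by move=> /hull_nonempty [k /finset.setIP[]]; exists k.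
have p_on t : `[0, 1]%classic t ->
    (p @^-1` on (pred1 (x i))) t <-> ~ (p @^-1` on (predC1 (x i))) t.
  rewrite /= in_itv /= => t01; have : D (p t) by exact: Dcvx.
  rewrite -supp => -[tau tF tp]; split.
    move=> [s1 /andP[s1F /forall_inP a1] h1] [s2 /andP[s2F /forall_inP a2] h2].
    have [k k1 k2] := hullI _ _ _ s1F s2F h1 h2.
    by have /negP := a2 _ k2; apply; exact: a1.
  move=> np; exists tau => //=; rewrite tF /=; apply/forall_inP => k kt.
  apply: contra_notT np => xk; exists tau => //=; rewrite tF /=.
  by apply/forall_inP => l lt; rewrite /= (xface tau l k).
have on1 : `[0, 1]%classic `&` p @^-1` on (pred1 (x i)) = `[0, 1]%classic.
  (* The set is nonempty (it contains 0), relatively open as the complement of the other closed set,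
     and relatively closed. *)
  apply: (@segment_connected R 0 1).
  - exists 0; split; first by rewrite /= in_itv /= lexx ler01.
    have [tau tF it] := inface i; exists tau.
      by rewrite /= tF /=; apply/forall_inP => k kt; rewrite /= (xface tau k i).
    by rewrite /p scale0r addr0; exact: hull_vtx.
  - exists (~` (p @^-1` on (predC1 (x i)))); first exact: closed_openC.
    apply/seteqP; split=> t [t01]; have := p_on t t01 => -[h1 h2].
      by move=> /h1.
    by move=> /h2.
  - by exists (p @^-1` on (pred1 (x i))).
have : (`[0, 1]%classic `&` p @^-1` on (pred1 (x i))) 1.
  by rewrite on1 /= in_itv /= ler01 lexx.
move=> [_ [tau /andP[tF /forall_inP xt]]].
rewrite /p scale1r addrC subrK => tj.
have [sigma sF js] := inface j.
(* The triangle found at parameter 1 contains the point [vtx M j] but is not known to have [j] as a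
   vertex; a vertex shared with a triangle at [j] makes the link. *)
have [k ks kt] := hullI _ _ _ sF tF (hull_vtx _ js) tj.
by rewrite (xface sigma j k) //; apply/esym/eqP; exact: xt.
Qed.

(** * Geometry of the rectangle *)

Lemma rect_segment_convex (R : realType) (a b : R) : segment_convex (rect a b).
Proof.
move=> x y t /andP[t0 t1]; rewrite /rect /= !coordE.
move=> /andP[/andP[? ?] /andP[? ?]] /andP[/andP[? ?] /andP[? ?]].
by apply/andP; split; apply/andP; split; nra.
Qed.

Lemma frontier_corner (R : realType) (a b : R) :
  0 <= a -> 0 <= b -> Defs.frontier (rect a b) (0 : 'rV[R]_2).
Proof.
move=> a0 b0; split.
  by apply: subset_closure; rewrite /rect /= !coordE !lexx a0 b0.
move=> /(near_line (- pt 1 1)) nr.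
have : \forall t \near (0 : R)^'+, 0 < t /\ rect a b (0 + t *: - pt 1 1).
  near=> t; split; near: t; last exact: nr.
  exact: nbhs_right_gt.
move=> /filter_ex [t [t0]]; rewrite /rect /= !coordE mxE /= => /andP[/andP[+ _] _].
by rewrite mulrN1 add0r oppr_ge0 leNgt t0.
Unshelve. all: by end_near.
Qed.

(** The corner is an extreme point: if a convex combination of points with nonnegative coordinates
    is 0, every point of nonzero weight is 0. *)
Lemma corner_vertex (R : realType) (a b : R) (n : nat) (M : mesh R n) :
  triangulation_of M (rect a b) -> 0 <= a -> 0 <= b -> exists k, vtx M k = 0.
Proof.
move=> [_ _ inface _ supp] a0 b0.
have Dv k : rect a b (vtx M k).
  have [tau tF kt] := inface k; rewrite -supp; exists tau => //.
  exact: hull_vtx.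
have : rect a b (0 : 'rV[R]_2) by rewrite /rect /= !coordE !lexx a0 b0.
rewrite -supp => -[tau _ [c [c0 c1 sum0]]].
have [k [kt ck]] : exists k, k \in tau /\ c k != 0.
  apply: contrapT => none; move: c1; rewrite big1 => [/eqP|k kt].
    by rewrite eq_sym oner_eq0.
  by apply/eqP; apply: contra_notT none => ck; exists k.
have coord_eq0 l : (forall h, 0 <= vtx M h 0 l) -> vtx M k 0 l = 0.
  move=> v0; have /eqP : \sum_(h in tau) c h * vtx M h 0 l = 0.
    rewrite -[RHS](coord0 R l) sum0 summxE.
    by apply: eq_bigr => h _; rewrite coordZ.
  rewrite psumr_eq0 => [/allP/(_ k (mem_index_enum _))|h _]; last exact: mulr_ge0.
  by rewrite kt /= mulf_eq0 (negbTE ck) /= => /eqP.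
exists k; apply/row2P; rewrite coord0 coord_eq0 // => h.
  by have /andP[/andP[]] := Dv h.
by have /andP[_ /andP[]] := Dv h.
Qed.

(** * The interior block as a Dirichlet form *)

Lemma posdef_unitmx (R : realType) (n : nat) (A : 'M[R]_n) :
  (forall x : 'cV[R]_n, x != 0 -> 0 < (x^T *m A *m x) 0 0) -> A \in unitmx.
Proof.
move=> pd; rewrite unitmxE unitfE; apply/negP => /det0P [v v0 vA].
have vT0 : v^T != 0 by rewrite -trmx0 (inj_eq trmx_inj).
by have := pd _ vT0; rewrite trmxK vA mul0mx mxE ltxx.
Qed.

Definition extend0 (R : realType) (ni nb : nat) (x : 'cV[R]_ni)
    (k : 'I_(ni + nb)) : R :=
  col_mx x (0 : 'cV[R]_nb) k 0.

Lemma dirichlet_extend0 (R : realType) (ni nb : nat) (M : mesh R (ni + nb))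
    (x : 'cV[R]_ni) (y : 'I_(ni + nb) -> R) :
  (forall tau, tau \in faces M -> nondegenerate M tau) ->
  dirichlet M (extend0 x) y = (x^T *m (Lmatrix M *m \col_k y k)) 0 0.
Proof.
move=> nd; rewrite dirichletE big_split_ord /= [X in _ + X]big1 ?addr0; last first.
  by move=> k _; rewrite /extend0 col_mxEd mxE mul0r.
rewrite mxE; apply: eq_bigr => i _; rewrite /extend0 col_mxEu mxE; congr (_ * _).
by rewrite mxE; apply: eq_bigr => j _; rewrite Lmatrix_stiffness // mxE.
Qed.

Lemma quadratic_extend0 (R : realType) (ni nb : nat) (M : mesh R (ni + nb))
    (x : 'cV[R]_ni) :
  (forall tau, tau \in faces M -> nondegenerate M tau) ->
  (x^T *m lsubmx (Lmatrix M) *m x) 0 0 =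
  dirichlet M (extend0 (nb := nb) x) (extend0 (nb := nb) x).
Proof.
move=> nd; rewrite dirichlet_extend0 // -mulmxA; congr ((_ *m _) 0 0).
have -> : \col_k extend0 (nb := nb) x k = col_mx x 0.
  by apply/colP => k; rewrite mxE.
by rewrite -[Lmatrix M in RHS]hsubmxK mul_row_col mulmx0 addr0.
Qed.

Lemma stieltjes_Lmatrix (R : realType) (ni nb : nat) (M : mesh R (ni + nb))
    (D : set 'rV[R]_2) (k0 : 'I_(ni + nb)) :
  triangulation_of M D -> delaunay M -> segment_convex D ->
  (forall k : 'I_(ni + nb), (k < ni)%N -> interior D (vtx M k)) ->
  (ni <= k0)%N ->
  stieltjes (lsubmx (Lmatrix M)).
Proof.
move=> tri del Dcvx Dint k0ni; have [_ nd _ _ _] := tri.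
have LaE i j : lsubmx (Lmatrix M) i j = stiffness M (lshift nb i) (lshift nb j).
  by rewrite mxE Lmatrix_stiffness.
split.
- by apply/matrixP => i j; rewrite mxE !LaE stiffnessC.
- move=> x x0; rewrite quadratic_extend0 //.
  rewrite lt_def dirichlet_ge0 // andbT; apply: contra x0.
  move=> /eqP/(dirichlet_eq0 nd) xface.
  (* The extended function is constant, and its value at the constrained vertex [k0] is 0. *)
  apply/eqP/colP => i; have := face_constant tri Dcvx xface (lshift nb i) k0.
  rewrite /extend0 col_mxEu [RHS]mxE => ->.
  rewrite mxE; case: splitP => j k0j; last by rewrite mxE.
  by have := ltn_ord j; rewrite -k0j ltnNge k0ni.
- move=> i j ij; rewrite LaE; apply: (stiffness_le0 tri del Dcvx).
  + by apply: Dint => /=.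
  + by apply: Dint => /=.
  + by apply: contra ij => /eqP/lshift_inj ->.
Qed.

(** * Energy and interpolation *)

(** Any affine representation of [f] on the triangle agrees at the vertices with the combination of
    hat functions, so [affine_ext] identifies the matrix chosen by [xget]. *)
Lemma grad_on_affine (R : realType) (n : nat) (M : mesh R n) (tau : {set 'I_n})
    (f : 'rV[R]_2 -> 'rV[R]_2) :
  nondegenerate M tau -> affine_on (hull M tau) f ->
  grad_on (hull M tau) f = \sum_k hat_grad M tau k *m f (vtx M k).
Proof.
move=> nd [G [c fE]].
pose G' := \sum_k hat_grad M tau k *m f (vtx M k).
pose c' := \sum_k hat_cst M tau k *: f (vtx M k).
have G'E l : l \in tau -> vtx M l *m G' + c' = f (vtx M l).
  move=> lt; rewrite mulmx_sumr -big_split /= (bigD1 l) //= big1 => [|k kl].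
    rewrite mulmxA [_ *m hat_grad _ _ _]mx11_scalar mul_scalar_mx -scalerDl.
    by rewrite (hatP l nd lt) eqxx scale1r addr0.
  rewrite mulmxA [_ *m hat_grad _ _ _]mx11_scalar mul_scalar_mx -scalerDl.
  by rewrite (hatP k nd lt) eq_sym (negbTE kl) scale0r.
have uniqG H d : (forall x, hull M tau x -> f x = x *m H + d) -> H = G'.
  move=> fH; have [|//] := @affine_ext _ _ _ _ _ H G' d c' nd.
  by move=> k kt; rewrite G'E // -fH //; exact: hull_vtx.
pose P : set 'M[R]_(2, 2) := fun H => exists d : 'rV[R]_2,
  forall x, hull M tau x -> f x = x *m H + d.
have : P (grad_on (hull M tau) f) by apply: (@xgetPex _ _ P); exists G, c.
by case=> e /uniqG.
Qed.

(** The squared Frobenius norm splits over columns, that is, over the two components of [f]. *)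
Lemma energy_dirichlet (R : realType) (n : nat) (M : mesh R n) (A : R)
    (f : 'rV[R]_2 -> 'rV[R]_2) :
  (forall tau, tau \in faces M -> nondegenerate M tau) ->
  (forall tau, tau \in faces M -> affine_on (hull M tau) f) ->
  conformal_energy M A f =
  - A + 2^-1 * \sum_(c < 2) dirichlet M (fun k => f (vtx M k) 0 c)
                                        (fun k => f (vtx M k) 0 c).
Proof.
move=> nd aff; rewrite /conformal_energy; congr (_ + _ * _).
rewrite exchange_big /=; apply: eq_bigr => tau tF.
rewrite (grad_on_affine (nd _ tF) (aff _ tF)) /frobenius_sq exchange_big /=.
rewrite mulr_suml; apply: eq_bigr => c _; rewrite mulrC; congr (_ * _).
have gE i : (\sum_k hat_grad M tau k *m f (vtx M k)) i c =
    pl_grad M tau (fun k => f (vtx M k) 0 c) i 0.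
  rewrite /pl_grad !summxE; apply: eq_bigr => k _.
  by rewrite mxE big_ord1 [RHS]mxE mulrC.
rewrite big_ord_recl big_ord1 !gE (_ : lift ord0 ord0 = 1) ?expr2 //.
exact/val_inj.
Qed.

(** On a face [s] the interpolant depends only on the values at the vertices of [s]; two triangles
    therefore give the same value on their common face. *)
Lemma pl_sub_face (R : realType) (n : nat) (M : mesh R n) (tau s : {set 'I_n})
    (c : 'I_n -> R) (F : 'I_n -> 'rV[R]_2) :
  nondegenerate M tau -> s \subset tau -> \sum_(k in s) c k = 1 ->
  \sum_(k in tau) hat M tau k (\sum_(h in s) c h *: vtx M h) *: F k =
  \sum_(k in s) c k *: F k.
Proof.
move=> nd st c1; rewrite (big_setID s) /= (finset.setIidPr st) [X in _ + X]big1.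
  by rewrite addr0; apply: eq_bigr => k ks; rewrite hat_comb // ks.
by move=> k /finset.setDP[_ ks]; rewrite hat_comb // (negbTE ks) scale0r.
Qed.

Lemma pl_interpolation (R : realType) (n : nat) (M : mesh R n)
    (D : set 'rV[R]_2) (F : 'I_n -> 'rV[R]_2) :
  triangulation_of M D ->
  exists f : 'rV[R]_2 -> 'rV[R]_2,
    [/\ {within D, continuous f},
        forall tau, tau \in faces M -> affine_on (hull M tau) f &
        forall k, f (vtx M k) = F k].
Proof.
move=> [_ nd inface meet supp].
(* An arbitrary triangle containing [x]; [fE] shows that the choice does not affect [f]. *)
pose T x := xget finset.set0 [set tau | tau \in faces M /\ hull M tau x].
pose f x := \sum_(k in T x) hat M (T x) k x *: F k.
have fE tau x : tau \in faces M -> hull M tau x ->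
    f x = \sum_(k in tau) hat M tau k x *: F k.
  move=> tF tx; rewrite /f /T; case: xgetP => [sigma _ [sF sx]|/(_ tau) []] //.
  have : hull M (sigma :&: tau) x by rewrite -meet.
  move=> [c [_ c1 ->]]; rewrite !pl_sub_face //.
  - exact: nd. - exact: finset.subsetIr.
  - exact: nd. - exact: finset.subsetIl.
exists f; split.
(* Continuity is glued along the finite list of triangles, one closed set at a time. *)
- have cont_on (s : seq {set 'I_n}) : {subset s <= faces M} ->
      {within \big[setU/set0]_(tau <- s) hull M tau, continuous f}.
    elim: s => [|tau s IH] sF; first by rewrite big_nil; exact: continuous_subspace0.
    have tF : tau \in faces M by apply: sF; rewrite mem_head.
    rewrite big_cons; apply: withinU_continuous.
    + exact: closed_hull (nd _ tF).
    + apply: closed_bigsetU => sigma ss.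
      by apply: closed_hull; apply: nd; apply: sF; rewrite inE ss orbT.
    + apply: (@subspace_eq_continuous _ _ _
        (fun x => \sum_(k in tau) hat M tau k x *: F k)).
        by move=> x /set_mem tx; rewrite [RHS](fE tau).
      apply: continuous_subspaceT; apply: continuous_big => [|k _ x].
        exact: add_continuous.
      by apply: continuousZr_tmp; exact: continuous_hat.
    + by apply: IH => sigma ss; apply: sF; rewrite inE ss orbT.
  have -> : D = \big[setU/set0]_(tau <- enum (faces M)) hull M tau.
    rewrite -supp; apply/seteqP; split=> x.
      move=> [tau tF tx]; rewrite -bigcup_seq; exists tau => //=.
      by rewrite mem_enum.
    rewrite -bigcup_seq => -[tau /=]; rewrite mem_enum => tF tx.
    by exists tau.
  by apply: cont_on => tau; rewrite mem_enum.
- move=> tau tF.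
  exists (\sum_(k in tau) hat_grad M tau k *m F k),
    (\sum_(k in tau) hat_cst M tau k *: F k).
  move=> x tx; rewrite (fE tau) // mulmx_sumr -big_split /=.
  apply: eq_bigr => k _.
  by rewrite mulmxA [_ *m hat_grad _ _ _]mx11_scalar mul_scalar_mx -scalerDl.
- move=> k; have [tau tF kt] := inface k.
  rewrite (fE tau) //; last exact: hull_vtx.
  rewrite (bigD1 k) //= big1 => [|l /andP[lt lk]].
    by rewrite hat_vtx ?eqxx ?scale1r ?addr0 //; exact: nd.
  by rewrite hat_vtx ?[k == l]eq_sym ?(negbTE lk) ?scale0r //; exact: nd.
Qed.

(** * Determination by nodal values and constraints *)

Lemma affine_on_vtx (R : realType) (n : nat) (M : mesh R n)
    (D : set 'rV[R]_2) (f h : 'rV[R]_2 -> 'rV[R]_2) :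
  triangulation_of M D ->
  (forall tau, tau \in faces M -> affine_on (hull M tau) f) ->
  (forall tau, tau \in faces M -> affine_on (hull M tau) h) ->
  (forall k, f (vtx M k) = h (vtx M k)) ->
  forall x, D x -> f x = h x.
Proof.
move=> [_ nd _ _ supp] aff afh fh x; rewrite -supp => -[tau tF tx].
have [[G [c fE]] [H [d hE]]] := (aff _ tF, afh _ tF).
have [|GH cd] := @affine_ext _ _ _ _ _ G H c d (nd _ tF).
  by move=> k kt; rewrite -fE -?hE ?fh //; exact: hull_vtx.
by rewrite fE // hE // GH cd.
Qed.

(** By disjointness at most one constrained set contains [k], so the constraints cannot conflict. *)
Lemma prescribed_ex (R : realType) (n : nat) (M : mesh R n)
    (D : set 'rV[R]_2) (K J : nat)
    (Os : 'I_K -> set 'rV[R]_2) (Ls : 'I_J -> set 'rV[R]_2)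
    (rO : R) (RL : 'I_J -> 'M[R]_2)
    (tO : 'I_K -> 'rV[R]_2) (tL : 'I_J -> 'rV[R]_2)
    (g : 'rV[R]_2 -> 'rV[R]_2) (k : 'I_n) :
  pairwise_disjoint (fun i => Omesh M (Os i)) (fun j => Lmesh M (Ls j))
    (Bmesh M D) ->
  exists y, prescribed M D Os Ls rO RL tO tL g k y.
Proof.
set X := fun i => Omesh M (Os i); set Y := fun j => Lmesh M (Ls j).
move=> disj; have uniq c c' : joint_family X Y (Bmesh M D) c k ->
    joint_family X Y (Bmesh M D) c' k -> c = c'.
  by move=> ck ck'; apply: disj => //; exists k.
have [[i Oi]|nO] := pselect (exists i, X i k).
  exists (rO *: vtx M k + tO i); split=> [i' Oi'|j Lj|Bk].
  - by have [->] := uniq (Some (inl i)) (Some (inl i')) Oi Oi'.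
  - by have := uniq (Some (inl i)) (Some (inr j)) Oi Lj.
  - by have := uniq (Some (inl i)) None Oi Bk.
have [[j Lj]|nL] := pselect (exists j, Y j k).
  exists (vtx M k *m (RL j)^T + tL j); split=> [i Oi|j' Lj'|Bk].
  - by case: nO; exists i.
  - by have [->] := uniq (Some (inr j)) (Some (inr j')) Lj Lj'.
  - by have := uniq (Some (inr j)) None Lj Bk.
(* This case includes the vertices in no constrained set, where every value is allowed. *)
exists (g (vtx M k)); split=> // [i Oi|j Lj].
- by case: nO; exists i.
- by case: nL; exists j.
Qed.

Lemma prescribed_uniq (R : realType) (n : nat) (M : mesh R n)
    (D : set 'rV[R]_2) (K J : nat)
    (Os : 'I_K -> set 'rV[R]_2) (Ls : 'I_J -> set 'rV[R]_2)
    (rO : R) (RL : 'I_J -> 'M[R]_2)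
    (tO : 'I_K -> 'rV[R]_2) (tL : 'I_J -> 'rV[R]_2)
    (g : 'rV[R]_2 -> 'rV[R]_2) (k : 'I_n) (y z : 'rV[R]_2) :
  ~ Imesh M D Os Ls k ->
  prescribed M D Os Ls rO RL tO tL g k y ->
  prescribed M D Os Ls rO RL tO tL g k z -> y = z.
Proof.
move=> nI [yO yL yB] [zO zL zB]; apply: contrapT => yz; apply: nI; split.
- by move=> i Oi; apply: yz; rewrite (yO i) // (zO i).
- by move=> j Lj; apply: yz; rewrite (yL j) // (zL j).
- by move=> Bk; apply: yz; rewrite yB // zB.
Qed.

Theorem theorem5 (R : realType) (a b w : R)
    (a_gt0 : 0 < a) (b_gt0 : 0 < b) (w_gt0 : 0 < w)
    (K J : nat) (Os : 'I_K -> set 'rV[R]_2) (Ls : 'I_J -> set 'rV[R]_2)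
    (Os_sub : forall i, Os i `<=` rect a b)
    (Ls_sub : forall j, Ls j `<=` rect a b)
    (OL_disjoint : pairwise_disjoint Os Ls (frontier (rect a b)))
    (rO : R) (rO_gt0 : 0 < rO)
    (RL : 'I_J -> 'M[R]_2)
    (RL_diag : forall j, is_diag_mx (RL j))
    (RL_gt0 : forall j i, 0 < RL j i i)
    (tO : 'I_K -> 'rV[R]_2) (tL : 'I_J -> 'rV[R]_2)
    (g : 'rV[R]_2 -> 'rV[R]_2)
    (g_bij : set_bij (frontier (rect a b)) (frontier (rect (w * a) b)) g)
    (g_cont : {within frontier (rect a b), continuous g})
    (g_00 : g (pt 0 0) = pt 0 0) (g_a0 : g (pt a 0) = pt (w * a) 0)
    (g_0b : g (pt 0 b) = pt 0 b) (g_ab : g (pt a b) = pt (w * a) b)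
    (ni nb : nat) (M : mesh R (ni + nb))
    (M_triangulation : triangulation_of M (rect a b))
    (OLB_disjoint : pairwise_disjoint (fun i => Omesh M (Os i))
                      (fun j => Lmesh M (Ls j)) (Bmesh M (rect a b)))
    (I_first : forall k : 'I_(ni + nb),
       Imesh M (rect a b) Os Ls k <-> (k < ni)%N)
    (M_simply_connected : simply_connected (mesh_support M))
    (M_delaunay : delaunay M) :
  let maps := SM M (rect a b) Os Ls rO RL tO tL g in
  let E := conformal_energy M (w * a * b) in
  let La := lsubmx (Lmatrix M) in
  let Lb := rsubmx (Lmatrix M) in
  let fb := prescribed_block M (rect a b) Os Ls rO RL tO tL g in
  stieltjes La /\
  exists f : 'rV[R]_2 -> 'rV[R]_2,
    [/\ is_minimizer E maps f,
        forall h, is_minimizer E maps h -> forall x, rect a b x -> h x = f x &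
        matrix_form M f = col_mx (- invmx La *m Lb *m fb) fb].
Proof.
move=> maps E La Lb fb; have [_ nd inface _ supp] := M_triangulation.
have [k0 v0] := corner_vertex M_triangulation (ltW a_gt0) (ltW b_gt0).
have k0ni : (ni <= k0)%N.
  rewrite leqNgt; apply/negP => /I_first [_ _]; apply; rewrite /Bmesh /= v0.
  by apply: frontier_corner; exact: ltW.
have Iint (k : 'I_(ni + nb)) : (k < ni)%N -> interior (rect a b) (vtx M k).
  move=> /I_first [_ _ nB]; apply: contrapT => nint; apply: nB; split=> //.
  apply: subset_closure; have [tau tF kt] := inface k; rewrite -supp.
  by exists tau => //; exact: hull_vtx.
have st : stieltjes La.
  exact: stieltjes_Lmatrix M_triangulation M_delaunay
    (@rect_segment_convex _ a b) Iint k0ni.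
split=> //; have [_ Lapd _] := st; have Lau := posdef_unitmx Lapd.
pose F := col_mx (- invmx La *m Lb *m fb) fb.
(* The upper block of [F] is the solution of [La *m X + Lb *m fb = 0]. *)
have LF : Lmatrix M *m F = 0.
  rewrite -[Lmatrix M]hsubmxK mul_row_col -/La -/Lb !mulNmx mulmxN !mulmxA.
  by rewrite mulmxV // mul1mx addNr.
have presc_I (k : 'I_(ni + nb)) y : (k < ni)%N ->
    prescribed M (rect a b) Os Ls rO RL tO tL g k y.
  by move=> /I_first [nO nL nB]; split=> [i /nO|j /nL|/nB].
have presc_B k : prescribed M (rect a b) Os Ls rO RL tO tL g (rshift ni k)
    (row k fb).
  rewrite rowK; pose P : set 'rV[R]_2 :=
    prescribed M (rect a b) Os Ls rO RL tO tL g (rshift ni k).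
  have [y Py] := prescribed_ex rO RL tO tL g (rshift ni k) OLB_disjoint.
  exact: (@xgetPex _ 0 P (ex_intro _ y Py)).
have [f [f_cont f_aff f_vtx]] :=
  pl_interpolation (fun k => row k F) M_triangulation.
have f_maps : maps f.
  split=> // k; rewrite f_vtx /F.
  case: (split_ordP k) => l ->; first exact: presc_I (lshift nb l) _ (ltn_ord l).
  by rewrite rowKd; exact: presc_B.
have vtxF k c : f (vtx M k) 0 c = F k c by rewrite f_vtx mxE.
(* A competitor differs from [f] only at interior vertices, by some [U]; its energy exceeds that of
   [f] by half the Dirichlet energy of [U] extended by 0. *)
have energy h : maps h -> exists U : 'M[R]_(ni, 2),
    (forall k c, h (vtx M k) 0 c = F k c + extend0 (nb := nb) (col c U) k) /\
    E h = E f + 2^-1 * \sum_(c < 2)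
      dirichlet M (extend0 (nb := nb) (col c U)) (extend0 (nb := nb) (col c U)).
  move=> [_ h_aff h_presc].
  pose U : 'M[R]_(ni, 2) := \matrix_(l, c)
    (h (vtx M (lshift nb l)) 0 c - F (lshift nb l) c).
  have hE k c : h (vtx M k) 0 c = F k c + extend0 (nb := nb) (col c U) k.
    rewrite /extend0; case: (split_ordP k) => l ->.
      by rewrite col_mxEu [col c U l 0]mxE [U l c]mxE addrC subrK.
    rewrite col_mxEd [(0 : 'cV[R]_nb) l 0]mxE addr0 /F col_mxEd.
    have -> : h (vtx M (rshift ni l)) = row l fb.
      apply: prescribed_uniq (h_presc _) (presc_B l).
      by move=> /I_first; rewrite /= ltnNge leq_addr.
    by rewrite mxE.
  exists U; split=> //; rewrite /E !energy_dirichlet //.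
  rewrite -addrA -mulrDr -big_split /=; congr (_ + _ * _).
  apply: eq_bigr => c _.
  have -> : (fun k => h (vtx M k) 0 c) =
      (fun k => F k c + extend0 (nb := nb) (col c U) k).
    by apply/funext => k; exact: hE.
  have -> : (fun k => f (vtx M k) 0 c) = F^~ c.
    by apply/funext => k; exact: vtxF.
  (* The test function vanishes at the constrained vertices, so only the interior rows act on [F],
     and these give [Lmatrix M *m F = 0]. *)
  have ortho : dirichlet M (extend0 (nb := nb) (col c U)) (F^~ c) = 0.
    rewrite dirichlet_extend0 //.
    have -> : \col_k F k c = col c F by apply/colP => k; rewrite !mxE.
    by rewrite (colE c F) (mulmxA (Lmatrix M)) LF mul0mx mulmx0 mxE.
  rewrite dirichletD dirichletC dirichletD [X in _ + X]dirichletC dirichletD.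
  by rewrite [dirichlet M (F^~ c) _ in X in _ + X]dirichletC ortho addr0 add0r.
have f_min : is_minimizer E maps f.
  split=> // h /energy [U [_ ->]]; rewrite lerDl mulr_ge0 ?invr_ge0 ?ler0n //.
  by apply: sumr_ge0 => c _; exact: dirichlet_ge0.
exists f; split=> //.
- move=> h [h_maps h_min].
  have [U [hE Eh]] := energy h h_maps.
  (* A nonzero column would have positive Dirichlet energy because [La] is positive definite, making
     [E h] larger than [E f]. *)
  have U0 c : col c U = 0.
    apply/eqP; apply: contraT => Uc0.
    have : 0 < dirichlet M (extend0 (nb := nb) (col c U))
                           (extend0 (nb := nb) (col c U)).
      rewrite -quadratic_extend0 //; exact: Lapd.
    have := h_min f f_maps; rewrite Eh -lerBrDl subrr pmulr_rle0 ?invr_gt0 //.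
    rewrite (bigD1 c) //= => le0 gt0.
    have ge0 : 0 <= \sum_(d < 2 | d != c)
        dirichlet M (extend0 (nb := nb) (col d U))
                    (extend0 (nb := nb) (col d U)).
      by apply: sumr_ge0 => d _; exact: dirichlet_ge0.
    by move: (ltr_wpDr ge0 gt0); rewrite ltNge le0.
  have [_ h_aff _] := h_maps.
  apply: (affine_on_vtx M_triangulation h_aff f_aff) => k.
  by apply/rowP => c; rewrite hE vtxF U0 /extend0 col_mx0 [X in _ + X]mxE addr0.
- by apply/matrixP => k c; rewrite mxE vtxF.
Qed.
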